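(* Let $k\geq 3$ and consider the Riemannian product $M^n\times\mathbb{R}^k$, whose points are denoted $(p,t,s)$ with $p\in M$, $t\in\mathbb{R}^{k-1}$, $s\in\mathbb{R}$, endowed with a product weight $e^{\psi(p,t,s)}:=e^{h(p)}\,e^{v(t)}$, where $h$ is a $C^1$ function on $M$ and $v(t)=\delta(|t|)$ for some non-decreasing $C^1$ function $\delta:[0,+\infty)\to\mathbb{R}$ with $\delta'(0)=0$. Let $\rho(p,t,s):=|t|^2-s^2$. If $\Sigma\subset M\times\mathbb{R}^k$ is a two-sided, compact and connected $\psi$-minimal hypersurface such that $\partial\Sigma\subset\{\rho\leq 0\}$, then $\partial\Sigma$ cannot intersect both of the cones $\{\rho\leq 0,\ s>0\}$ and $\{\rho\leq 0,\ s<0\}$.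
   Context: $M^n$ is a connected oriented $n$-dimensional Riemannian manifold, possibly with smooth boundary. For a two-sided smooth hypersurface $\Sigma$ (possibly with smooth boundary $\partial\Sigma$) with unit normal $N$, the $\psi$-mean curvature is $H_\psi:=-\operatorname{div}_\Sigma N-\langle\nabla\psi,N\rangle$, and $\Sigma$ is $\psi$-minimal if $H_\psi=0$ on $\Sigma$. *)

(* Defs.v *)
From HB Require Import structures.
From mathcomp Require Import all_boot all_order all_algebra.
From mathcomp Require Import all_classical all_reals.
From mathcomp Require Import topology normedtype sequences derive.

Set Implicit Arguments.
Unset Strict Implicit.
Unset Printing Implicit Defensive.

Import Order.TTheory GRing.Theory Num.Theory numFieldNormedType.Exports.

Local Open Scope classical_set_scope.
Local Open Scope ring_scope.

(* The library norm on 'rV[R]_m is the sup norm. *)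
Definition eucl_norm (R : realType) (m : nat) (t : 'rV[R]_m) : R :=
  Num.sqrt (\sum_(a < m) t 0 a ^+ 2).

(* [f] is C^k on the open set [U] (for finite-dimensional [V]): all iterated
   directional derivatives of order at most [k] exist and are continuous. *)
Fixpoint Ck_on (R : realType) (V W : normedModType R) (k : nat) (U : set V)
    (f : V -> W) : Prop :=
  (forall x, U x -> {for x, continuous f}) /\
  match k with
  | 0%N => True
  | k'.+1 => forall v, (forall x, U x -> derivable f x v) /\
                       Ck_on k' U (fun x => 'D_v f x)
  end.

Definition smooth_on (R : realType) (V W : normedModType R) (U : set V)
    (f : V -> W) : Prop := forall k, Ck_on k U f.

(* On a set that need not be open, regularity is the existence, near each point
   of the set, of an extension which is regular on an open set. *)
Definition locally_extends (R : realType) (V W : normedModType R)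
    (regular : set V -> (V -> W) -> Prop) (A : set V) (f : V -> W) : Prop :=
  forall x, A x -> exists (U : set V) (F : V -> W),
    [/\ open U, U x, regular U F & forall y, U y -> A y -> f y = F y].

Definition Ck_within (R : realType) (V W : normedModType R) (k : nat)
    (A : set V) (f : V -> W) : Prop := locally_extends (Ck_on k) A f.

Definition smooth_within (R : realType) (V W : normedModType R)
    (A : set V) (f : V -> W) : Prop := locally_extends (@smooth_on R V W) A f.

(* The directional derivative computed with the increments that stay in [A].
   It is 'D_v f x when [A] is a neighborhood of [x].  When [A] is relatively
   open in a closed half-space and [x] is on its wall, it is the (possibly
   one-sided) derivative in every direction [v], inward or outward; it agrees
   with 'D_v of any C^1 extension of [f]. *)
Definition derive_in (R : realType) (V W : normedModType R) (A : set V)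
    (f : V -> W) (x v : V) : W :=
  lim (h^-1 *: (f (h *: v + x) - f x)
        @[h --> within [set h : R | A (h *: v + x)] 0^']).

Definition partial_in (R : realType) (m : nat) (W : normedModType R)
    (A : set 'rV[R]_m) (f : 'rV[R]_m -> W) (x : 'rV[R]_m) (a : 'I_m) : W :=
  derive_in A f x (delta_mx 0 a).

(* Tangent vectors are row vectors: row [a] is the [a]-th partial derivative,
   and the differential of [f] at [x] is [v |-> v *m jacobian_in A f x]. *)
Definition jacobian_in (R : realType) (m p : nat) (A : set 'rV[R]_m)
    (f : 'rV[R]_m -> 'rV[R]_p) (x : 'rV[R]_m) : 'M[R]_(m, p) :=
  \matrix_(a, b) partial_in A f x a 0 b.

(* A chart takes its values in R^e ([wall = None]) or in the closed half-space
   [0 <= x_a] ([wall = Some a]).  Only the values of [cfun] on [cdom] and of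
   [cinv] on the image of [cdom] are meaningful. *)
Record chart (R : realType) (T : topologicalType) (e : nat) := Chart {
  cdom : set T;
  cfun : T -> 'rV[R]_e;
  cinv : 'rV[R]_e -> T;
  wall : option 'I_e }.

Definition model_space (R : realType) (e : nat) (w : option 'I_e) :
    set 'rV[R]_e :=
  if w is Some a then [set x : 'rV[R]_e | 0 <= x 0 a] else setT.

Definition cimg (R : realType) (T : topologicalType) (e : nat)
    (c : chart R T e) : set 'rV[R]_e := cfun c @` cdom c.

Definition on_wall (R : realType) (T : topologicalType) (e : nat)
    (c : chart R T e) (p : T) : Prop :=
  exists2 a, wall c = Some a & cfun c p 0 a = 0.

(* [c] is a homeomorphism from a relatively open subset of the subspace [S]
   onto a relatively open subset of its model space. *)
Record chart_on (R : realType) (T : topologicalType) (e : nat) (S : set T)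
    (c : chart R T e) : Prop := ChartOn {
  cdom_open : exists2 O : set T, open O & cdom c = S `&` O;
  cimg_open : exists2 O : set 'rV[R]_e, open O &
                cimg c = @model_space R e (wall c) `&` O;
  cfunK : forall p, cdom c p -> cinv c (cfun c p) = p;
  cfun_continuous : {within cdom c, continuous (cfun c)};
  cinv_continuous : {within cimg c, continuous (cinv c)} }.

(* An atlas, together with the Gram matrices of a metric in its charts. *)
Record metric_atlas (R : realType) (T : topologicalType) (e : nat) :=
  MetricAtlas {
    chart_index : Type;
    chart_at : chart_index -> chart R T e;
    metric_at : chart_index -> 'rV[R]_e -> 'M[R]_e }.

Definition gram (R : realType) (T : topologicalType) (e : nat)
    (D : metric_atlas R T e) (i : chart_index D) (p : T) : 'M[R]_e :=
  metric_at i (cfun (chart_at i) p).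

Definition overlap (R : realType) (T : topologicalType) (e : nat)
    (D : metric_atlas R T e) (i j : chart_index D) : set T :=
  cdom (chart_at i) `&` cdom (chart_at j).

Definition transition (R : realType) (T : topologicalType) (e : nat)
    (D : metric_atlas R T e) (i j : chart_index D) : 'rV[R]_e -> 'rV[R]_e :=
  cfun (chart_at j) \o cinv (chart_at i).

Definition transition_jacobian (R : realType) (T : topologicalType) (e : nat)
    (D : metric_atlas R T e) (i j : chart_index D) (p : T) : 'M[R]_e :=
  jacobian_in (cfun (chart_at i) @` overlap i j) (transition i j)
    (cfun (chart_at i) p).

Record riemannian_manifold (R : realType) (T : topologicalType) (e : nat)
    (D : metric_atlas R T e) : Prop := RiemannianManifold {
  rm_hausdorff : hausdorff_space T;
  rm_countable : @second_countable T;
  rm_chart : forall i : chart_index D, chart_on setT (chart_at i);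
  rm_cover : forall p : T, exists i : chart_index D, cdom (chart_at i) p;
  rm_transition : forall i j : chart_index D,
    smooth_within (cfun (chart_at i) @` overlap i j) (transition i j);
  rm_metric_smooth : forall (i : chart_index D) (a b : 'I_e),
    smooth_within (cimg (chart_at i)) (fun x => metric_at i x a b : R);
  rm_metric_sym : forall (i : chart_index D) (p : T), cdom (chart_at i) p ->
    (gram i p)^T = gram i p;
  rm_metric_pos : forall (i : chart_index D) (p : T) (v : 'rV[R]_e),
    cdom (chart_at i) p -> v != 0 -> 0 < (v *m gram i p *m v^T) 0 0;
  rm_metric_compat : forall (i j : chart_index D) (p : T), overlap i j p ->
    gram i p = transition_jacobian i j p *m gram j p
                 *m (transition_jacobian i j p)^T }.

(* [o i p] tells whether the coordinate frame of the chart [i] at [p] is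
   positively oriented. *)
Definition orientation (R : realType) (T : topologicalType) (e : nat)
    (D : metric_atlas R T e) (o : chart_index D -> T -> bool) : Prop :=
  (forall (i : chart_index D) p, cdom (chart_at i) p ->
     \forall q \near p, o i q = o i p) /\
  (forall (i j : chart_index D) p, overlap i j p ->
     (0 < \det (transition_jacobian i j p)) = (o i p == o j p)).

Definition Ck_function (R : realType) (T : topologicalType) (e : nat)
    (D : metric_atlas R T e) (k : nat) (f : T -> R) : Prop :=
  forall i : chart_index D,
    Ck_within k (cimg (chart_at i)) (f \o cinv (chart_at i) : _ -> R).

Section ProductDef.
Context (R : realType) (T : topologicalType) (n q : nat).

Definition prod_coord (x : 'rV[R]_n) (t : 'rV[R]_q) (s : R) :
    'rV[R]_(n + q + 1) := row_mx (row_mx x t) s%:M.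

Definition prod_chart (c : chart R T n) :
    chart R (T * 'rV[R]_q * R)%type (n + q + 1) :=
  {| cdom := [set z | cdom c z.1.1];
     cfun := fun z => prod_coord (cfun c z.1.1) z.1.2 z.2;
     cinv := fun x => (cinv c (lsubmx (lsubmx x)), rsubmx (lsubmx x),
                       rsubmx x 0 0);
     wall := omap (fun a => lshift 1 (lshift q a)) (wall c) |}.

Definition prod_atlas (D : metric_atlas R T n) :
    metric_atlas R (T * 'rV[R]_q * R)%type (n + q + 1) :=
  {| chart_index := chart_index D;
     chart_at := fun i => prod_chart (chart_at i);
     metric_at := fun i x =>
       block_mx (block_mx (metric_at i (lsubmx (lsubmx x))) 0 0 1%:M)
                0 0 1%:M |}.

End ProductDef.

Section HypersurfaceDef.
Context (R : realType) (T : topologicalType) (e : nat).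
Context (D : metric_atlas R T e).

(* The coordinates, in a chart [c] of a hypersurface, of the points that also
   lie in the domain of the ambient chart [i]. *)
Definition hs_dom (c : chart R T e.-1) (i : chart_index D) : set 'rV[R]_e.-1 :=
  cfun c @` (cdom c `&` cdom (chart_at i)).

Definition hs_jacobian (c : chart R T e.-1) (i : chart_index D) (p : T) :
    'M[R]_(e.-1, e) :=
  jacobian_in (hs_dom c i) (cfun (chart_at i) \o cinv c) (cfun c p).

(* The inverse of [c] is an immersion which is a homeomorphism onto a
   relatively open subset of [S]. *)
Definition hypersurface_chart (S : set T) (c : chart R T e.-1) : Prop :=
  [/\ chart_on S c,
      forall i : chart_index D,
        smooth_within (hs_dom c i) (cfun (chart_at i) \o cinv c) &
      forall (i : chart_index D) p, cdom c p -> cdom (chart_at i) p ->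
        row_free (hs_jacobian c i p)].

Definition hypersurface (S : set T) : Prop :=
  forall p, S p -> exists2 c, hypersurface_chart S c & cdom c p.

Definition hs_boundary (S : set T) : set T :=
  [set p | exists c, [/\ hypersurface_chart S c, cdom c p & on_wall c p]].

(* [N i p] is the coordinate vector of the normal at [p] in the chart [i]. *)
Definition unit_normal (S : set T) (N : chart_index D -> T -> 'rV[R]_e) : Prop :=
  [/\ forall (i j : chart_index D) p, S p -> overlap i j p ->
        N j p = N i p *m transition_jacobian i j p,
      forall c (i : chart_index D), hypersurface_chart S c ->
        smooth_within (hs_dom c i) (N i \o cinv c),
      forall (i : chart_index D) p, S p -> cdom (chart_at i) p ->
        N i p *m gram i p *m (N i p)^T = 1%:M &
      forall c (i : chart_index D) p, hypersurface_chart S c -> cdom c p ->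
        cdom (chart_at i) p ->
        N i p *m gram i p *m (hs_jacobian c i p)^T = 0].

(* Gamma^m_{ab} = 1/2 g^{ml} (d_a g_{bl} + d_b g_{al} - d_l g_{ab}) *)
Definition christoffel (i : chart_index D) (p : T) (m a b : 'I_e) : R :=
  let dg c a' b' :=
    partial_in (cimg (chart_at i)) (fun x => metric_at i x a' b' : R)
      (cfun (chart_at i) p) c in
  2^-1 * \sum_l invmx (gram i p) m l * (dg a b l + dg b a l - dg l a b).

(* Row [u] is the covariant derivative of [N] along the [u]-th coordinate
   vector field of the hypersurface. *)
Definition cov_normal (N : chart_index D -> T -> 'rV[R]_e) (c : chart R T e.-1)
    (i : chart_index D) (p : T) : 'M[R]_(e.-1, e) :=
  jacobian_in (hs_dom c i) (N i \o cinv c) (cfun c p) +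
  \matrix_(u, m) \sum_a \sum_b
    christoffel i p m a b * hs_jacobian c i p u a * N i p 0 b.

Definition first_fundamental_form (c : chart R T e.-1) (i : chart_index D) (p : T) :
    'M[R]_e.-1 :=
  hs_jacobian c i p *m gram i p *m (hs_jacobian c i p)^T.

(* div_Sigma N is the trace over the tangent space of
   (X, Y) |-> <nabla_X N, Y>, that is, h^{uw} <nabla_u N, d_w>. *)
Definition hs_divergence (N : chart_index D -> T -> 'rV[R]_e) (c : chart R T e.-1)
    (i : chart_index D) (p : T) : R :=
  \tr (invmx (first_fundamental_form c i p) *m
       (cov_normal N c i p *m gram i p *m (hs_jacobian c i p)^T)).

Definition gradient (f : T -> R) (i : chart_index D) (p : T) : 'rV[R]_e :=
  (\row_a partial_in (cimg (chart_at i)) (f \o cinv (chart_at i) : _ -> R)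
            (cfun (chart_at i) p) a) *m invmx (gram i p).

Definition psi_mean_curvature (psi : T -> R) (N : chart_index D -> T -> 'rV[R]_e)
    (c : chart R T e.-1) (i : chart_index D) (p : T) : R :=
  - hs_divergence N c i p - (gradient psi i p *m gram i p *m (N i p)^T) 0 0.

Definition psi_minimal (psi : T -> R) (S : set T)
    (N : chart_index D -> T -> 'rV[R]_e) : Prop :=
  forall c (i : chart_index D) p, hypersurface_chart S c -> cdom c p ->
    cdom (chart_at i) p -> psi_mean_curvature psi N c i p = 0.

End HypersurfaceDef.

Definition rho (R : realType) (T : Type) (q : nat) (z : T * 'rV[R]_q * R) : R :=
  eucl_norm z.1.2 ^+ 2 - z.2 ^+ 2.

(* Main.v *)
Require Import Defs.
From HB Require Import structures.
From mathcomp Require Import all_boot all_order all_algebra.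
From mathcomp Require Import all_classical all_reals.
From mathcomp Require Import topology normedtype sequences derive.
From mathcomp Require Import exp ring lra zify.

Set Implicit Arguments.
Unset Strict Implicit.
Unset Printing Implicit Defensive.

Import Order.TTheory GRing.Theory Num.Theory numFieldNormedType.Exports.

Local Open Scope classical_set_scope.
Local Open Scope ring_scope.

(* For eps > 0 the function f = (1 + eps) |t|^2 - s^2 is strictly
   psi-subharmonic on a psi-minimal hypersurface as soon as q = k - 1 >= 2, so it
   has no interior maximum.  Letting eps be small gives rho <= 0 on Sigma.  No
   strong maximum principle is needed: if the boundary met both cones, Sigma,
   being connected, would contain a point with s = 0, hence t = 0.  At such a
   point, on the boundary or not, the condition |t|^2 <= s^2 forces every tangent
   vector with ds = 0 to have dt = 0, hence to be tangent to M, and the space of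
   these vectors has dimension at least n + q - 1 > n.

   At an interior maximum p of f, let J be the Jacobian of a parametrization X,
   G = J g J^T the first fundamental form, Q = diag (0, 1 + eps, -1) half the
   Hessian of f, and V = X Q half its gradient.  Then J V^T = 0, so V = lam N.
   Differentiating <N, d_w X> = 0 turns the second-order part K of the Hessian of
   f along the hypersurface into - lam times the second fundamental form, and
   taking the trace against G^-1 with psi-minimality gives
     tr Q - Q(N, N) + d psi(V) <= 0,
   whereas the left-hand side is at least (1 + eps) (q - 1) - 1 > 0. *)

(** * Linear algebra of a hypersurface *)

(* Symmetric Gaussian elimination peels off one rank-one positive term of [S]. *)
Lemma trace_posdef_le0 (R : realFieldType) m (S H : 'M[R]_m) :
  S^T = S -> (forall v : 'rV_m, v != 0 -> 0 < (v *m S *m v^T) 0 0) ->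
  (forall v : 'rV_m, (v *m H *m v^T) 0 0 <= 0) -> \tr (S *m H) <= 0.
Proof.
elim: m S H => [|m IHm] S H; first by rewrite /mxtrace big_ord0.
rewrite -[m.+1]/(1 + m)%N in S H *.
rewrite -(submxK S) -(submxK H).
set a := ulsubmx S; set b := ursubmx S; set b' := dlsubmx S; set C := drsubmx S.
set p := ulsubmx H; set q := ursubmx H; set r := dlsubmx H; set K := drsubmx H.
rewrite tr_block_mx => /eq_block_mx [_ b'b _ CC] S_gt0 H_le0.
have {}b'b : b' = b^T by rewrite -[LHS]trmxK b'b.
have K_le0 (w : 'rV_m) : (w *m K *m w^T) 0 0 <= 0.
  have := H_le0 (row_mx 0 w).
  by rewrite mul_row_block tr_row_mx mul_row_col !mul0mx trmx0 mulmx0 !add0r.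
pose al := a 0 0.
have aE : a = al%:M by exact: mx11_scalar.
have al_gt0 : 0 < al.
  have := S_gt0 (row_mx 1%:M 0).
  rewrite mul_row_block tr_row_mx mul_row_col !mul0mx trmx0 mulmx0 !addr0.
  rewrite trmx1 mulmx1 mul1mx; apply.
  apply/eqP => /matrixP /(_ 0 (lshift m 0)) /eqP.
  by rewrite row_mxEl !mxE eqxx oner_eq0.
(* [C'] is the Schur complement of the pivot [al]; the induction hypothesis is applied to it. *)
pose C' := C - al^-1 *: (b^T *m b).
pose u := row_mx a b.
have decomp : block_mx a b b' C = al^-1 *: (u^T *m u) + block_mx 0 0 0 C'.
  rewrite /u tr_row_mx mul_col_row scale_block_mx add_block_mx !addr0.
  rewrite aE tr_scalar_mx mul_mx_scalar !mul_scalar_mx.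
  rewrite !scalerA mulVf ?gt_eqF// !scale1r b'b /C' (addrC (al^-1 *: _)) subrK.
  by rewrite mul_mx_scalar scalerA mulVf ?gt_eqF// scale1r.
have CT : C'^T = C'.
  by rewrite /C' linearB linearZ /= trmx_mul trmxK CC.
have C_gt0 (w : 'rV_m) : w != 0 -> 0 < (w *m C' *m w^T) 0 0.
  (* The first coordinate of [v] makes [v *m u^T] vanish. The rank-one term is then zero on [v], so
     the value of [C'] at [w] is the value of [S] at [v]. *)
  move=> w0; pose v := row_mx (- al^-1 *: (w *m b^T)) w.
  have v0 : v != 0.
    apply: contra w0 => /eqP /(congr1 rsubmx).
    by rewrite /v row_mxKr => ->; rewrite linear0.
  have vu : v *m u^T = 0.
    rewrite /v /u tr_row_mx mul_row_col aE tr_scalar_mx mul_mx_scalar scalerA.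
    by rewrite mulrN mulfV ?gt_eqF// scaleN1r addNr.
  have := S_gt0 v v0; rewrite decomp mulmxDr mulmxDl.
  rewrite -scalemxAr mulmxA vu mul0mx scaler0 mul0mx add0r.
  by rewrite /v mul_row_block tr_row_mx mul_row_col !mulmx0 !add0r mul0mx add0r.
(* The rank-one term contributes [al^-1] times the value of [H] at [u], which is nonpositive. *)
rewrite decomp mulmxDl mxtraceD -[leRHS]addr0 lerD//.
  rewrite -scalemxAl mxtraceZ pmulr_rle0 ?invr_gt0//.
  by rewrite -mulmxA mxtrace_mulC [mulmx _ _]mx11_scalar mxtrace_scalar mulr1n.
rewrite mulmx_block !mul0mx !addr0 !add0r mxtrace_block mxtrace0 add0r.
exact: IHm.
Qed.

Lemma diag_quadE (R : comPzRingType) (e : nat) (w v : 'rV[R]_e) :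
  (v *m diag_mx w *m v^T) 0 0 = \sum_b w 0 b * v 0 b ^+ 2.
Proof.
rewrite mul_mx_diag mxE; apply: eq_bigr => b _.
by rewrite !mxE mulrAC mulrC expr2.
Qed.

Section HypersurfaceAlgebra.
Context (R : realFieldType) (m e : nat) (J : 'M[R]_(m, e)) (g : 'M[R]_e)
  (nu : 'rV[R]_e).
Context (em : (e <= m.+1)%N) (J_free : row_free J) (g_sym : g^T = g)
  (g_pos : forall v : 'rV_e, v != 0 -> 0 < (v *m g *m v^T) 0 0)
  (nu_unit : nu *m g *m nu^T = 1%:M) (nu_normal : nu *m g *m J^T = 0).

Let G := J *m g *m J^T.

Lemma posdef_unitmx k (A : 'M[R]_k) :
  (forall v : 'rV_k, v != 0 -> 0 < (v *m A *m v^T) 0 0) -> A \in unitmx.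
Proof.
move=> A_pos; rewrite -row_free_unit -kermx_eq0; apply/rowV0P => v /sub_kermxP vA.
by apply/eqP/negPn/negP => /A_pos; rewrite vA mul0mx mxE ltxx.
Qed.

Lemma first_form_sym : G^T = G.
Proof. by rewrite /G !trmx_mul trmxK g_sym mulmxA. Qed.

Lemma first_form_pos (v : 'rV_m) : v != 0 -> 0 < (v *m G *m v^T) 0 0.
Proof.
move=> v0; have /g_pos : v *m J != 0.
  by apply: contra v0 => /eqP vJ; apply/eqP/(row_free_inj J_free); rewrite vJ mul0mx.
by rewrite trmx_mul /G !mulmxA.
Qed.

Lemma first_form_unit : G \in unitmx.
Proof. exact: posdef_unitmx first_form_pos. Qed.

(** Right multiplication by the left side fixes the rows of [J] and [nu]. These span the whole
    space: [nu] is a unit vector orthogonal to the rows of [J], hence outside their span, and [J]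
    has rank [m] with [e <= m.+1]. The two terms are the [g]-orthogonal projections onto the tangent
    space and onto the normal line. *)
Lemma normal_tangent_decomposition :
  g *m J^T *m invmx G *m J + g *m nu^T *m nu = 1%:M.
Proof.
set P := LHS.
have Jnu : J *m g *m nu^T = 0.
  by apply: trmx_inj; rewrite !trmx_mul trmxK g_sym mulmxA nu_normal trmx0.
have JP : J *m P = J.
  rewrite /P mulmxDr !mulmxA -/G mulmxV ?first_form_unit// mul1mx.
  by rewrite Jnu mul0mx addr0.
have nuP : nu *m P = nu.
  by rewrite /P mulmxDr !mulmxA nu_normal !mul0mx add0r nu_unit mul1mx.
have nuJ : (nu <= J)%MS = false.
  apply/negP => /submxP [v nuv]; have := nu_unit.
  rewrite {2}nuv trmx_mul mulmxA nu_normal mul0mx => /matrixP /(_ 0 0) /eqP.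
  by rewrite !mxE eqxx eq_sym oner_eq0.
have full : row_full (col_mx J nu).
  rewrite -col_leq_rank -addsmxE (leq_trans em)//.
  have JJ : (J <= J + nu)%MS by exact: addsmxSl.
  have : (\rank J < \rank (J + nu))%N.
    rewrite ltn_neqAle mxrankS// andbT (mxrank_leqif_sup JJ).
    by rewrite addsmx_sub nuJ andbF.
  by rewrite (eqP J_free).
have [L LK] := row_fullP full.
by rewrite -[P]mul1mx -[in LHS]LK -mulmxA mul_col_mx JP nuP LK.
Qed.

(** The equation [V *m g = V] makes [V] its own [g]-dual, so [J *m V^T = 0] is orthogonality to the
    tangent space and only the normal projection of [V] survives. *)
Lemma normal_collinear (V : 'rV_e) : V *m g = V -> J *m V^T = 0 ->
  V = (V *m nu^T) 0 0 *: nu.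
Proof.
move=> Vg JV; rewrite -[LHS]mulmx1 -normal_tangent_decomposition mulmxDr.
rewrite !mulmxA Vg -[V *m J^T]trmxK trmx_mul trmxK JV trmx0 !mul0mx add0r.
by rewrite [V *m nu^T in LHS]mx11_scalar mul_scalar_mx.
Qed.

(** By cyclicity the left side is the trace of the tangential projection times [Q], and that
    projection is the identity minus the normal one. The relation [g *m Q = Q] absorbs the metric
    factors. *)
Lemma trace_tangent (Q : 'M_e) : g *m Q = Q -> Q^T = Q ->
  \tr (invmx G *m (J *m Q *m J^T)) = \tr Q - (nu *m Q *m nu^T) 0 0.
Proof.
move=> gQ QT; have Qg : Q *m g = Q by rewrite -[Q in LHS]QT -[g]g_sym -trmx_mul gQ.
transitivity (\tr ((g *m J^T *m invmx G *m J) *m Q)).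
  rewrite -[in LHS]Qg -!mulmxA mxtrace_mulC !mulmxA mxtrace_mulC.
  by rewrite !mulmxA mxtrace_mulC !mulmxA mxtrace_mulC !mulmxA.
have -> : g *m J^T *m invmx G *m J = 1%:M - g *m nu^T *m nu.
  by rewrite -normal_tangent_decomposition addrK.
rewrite mulmxBl mul1mx linearB /=; congr (_ - _).
rewrite -!mulmxA mxtrace_mulC -!mulmxA Qg mxtrace_mulC.
by rewrite mulmxA [_ *m nu^T in LHS]mx11_scalar mxtrace_scalar mulr1n.
Qed.

(** The Hessian bound is traced against [invmx G], which is positive definite because its value at
    [v] is the value of [G] at [v *m invmx G]. *)
Lemma trace_second_order (Q : 'M_e) (K : 'M_m) : g *m Q = Q -> Q^T = Q ->
  (forall v : 'rV_m, (v *m (J *m Q *m J^T + K) *m v^T) 0 0 <= 0) ->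
  \tr Q - (nu *m Q *m nu^T) 0 0 + \tr (invmx G *m K) <= 0.
Proof.
move=> gQ QT H_le0; rewrite -trace_tangent// -mxtraceD -mulmxDr.
have GT : (invmx G)^T = invmx G by rewrite trmx_inv first_form_sym.
apply: trace_posdef_le0 => // v v0.
have /first_form_pos : v *m invmx G != 0.
  apply: contra v0 => /eqP vG.
  by rewrite -[v](mulmxK first_form_unit) -(mulmxKV first_form_unit v) vG !mul0mx.
by rewrite trmx_mul GT mulmxKV ?first_form_unit// mulmxA.
Qed.

End HypersurfaceAlgebra.

(** * Directional derivatives *)

Lemma line_continuous (R : realType) (V : normedModType R) (x v : V) :
  continuous (fun h : R => h *: v + x).
Proof.
by move=> h; apply: cvgD; [apply: scalel_continuous | exact: cvg_cst].
Qed.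

Lemma near_line (R : realType) (V : normedModType R) (x v : V) (P : set V) :
  (\forall y \near x, P y) -> \forall h \near (0 : R), P (h *: v + x).
Proof.
move=> Px; have := @line_continuous R V x v 0.
by rewrite /continuous_at scale0r add0r; apply; exact: Px.
Qed.

Lemma near_dnbhs_right (R : realType) (a : R) (P : set R) :
  (\forall h \near a^', P h) -> \forall h \near a^'+, P h.
Proof.
rewrite /dnbhs /at_right !near_withinE; apply: filterS => h Ph ah.
by apply: Ph; rewrite gt_eqF.
Qed.

(** At a point of a wall only increments of one sign may stay in [A]. Small positive ones already
    make the restricted filter proper, so the limit in [derive_in] is unique. *)
Lemma within_line_proper (R : realType) (V : normedModType R) (A : set V) (x v : V) :
  (\forall h \near (0 : R)^'+, A (h *: v + x)) ->
  ProperFilter (within [set h : R | A (h *: v + x)] 0^').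
Proof.
move=> Ax; apply: Build_ProperFilter_ex => B /near_dnbhs_right B0.
near (0 : R)^'+ => h; exists h.
have Ah : A (h *: v + x) by near: h.
by move: Ah; near: h.
Unshelve. all: by end_near. Qed.

Lemma derive_inE (R : realType) (V W : normedModType R) (A : set V)
    (f F : V -> W) (x v : V) :
  (\forall h \near (0 : R)^'+, A (h *: v + x)) -> A x ->
  (\forall y \near x, A y -> f y = F y) ->
  derivable F x v -> derive_in A f x v = 'D_v F x.
Proof.
move=> Ah Ax fF Fx; have pf := within_line_proper Ah.
rewrite /derive_in; apply: cvg_lim => //.
have fFx : f x = F x by exact: (nbhs_singleton fF).
have : (h^-1 *: (F (h *: v + x) - F x)
        @[h --> within [set h : R | A (h *: v + x)] 0^']) --> 'D_v F x.
  apply: cvg_trans (Fx) => /=.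
  apply: cvg_app; exact: cvg_within.
apply: cvg_trans; apply: near_eq_cvg; rewrite fFx.
have := near_line v fF => fFl.
rewrite near_withinE; near=> h => Axh.
by rewrite (near (nbhs_dnbhs fFl) h).
Unshelve. all: by end_near. Qed.

Lemma is_derive_line (R : realType) (V W : normedModType R) (f : V -> W)
    (x v : V) (a : R) (df : W) :
  is_derive (a *: v + x) v f df ->
  is_derive a 1 (fun h : R => f (h *: v + x)) df.
Proof.
set g := fun h : R => _.
have E : (fun h : R => h^-1 *: ((g \o shift a) (h *: 1) - g a)) =
   (fun h => h^-1 *: ((f \o shift (a *: v + x)) (h *: v) - f (a *: v + x))).
  by apply/funext => h; rewrite /g /= [h%:A]mulr1 scalerDl addrA.
by case=> fx <-; apply: DeriveDef; rewrite /derivable /derive E.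
Qed.

Lemma is_deriveZv (R : realType) (V W : normedModType R) (f : V -> W)
    (x v : V) (a : R) :
  derivable f x v -> is_derive x (a *: v) f (a *: 'D_v f x).
Proof.
move=> fx; have [->|a0] := eqVneq a 0.
  by rewrite !scale0r; exact: is_derive0.
have H : (fun h : R => h^-1 *: ((f \o shift x) (h *: (a *: v)) - f x)) @ 0^'
          --> a *: 'D_v f x.
  have -> : (fun h : R => h^-1 *: ((f \o shift x) (h *: (a *: v)) - f x)) =
    (fun h => a *: (h^-1 *: ((f \o shift x) (h *: v) - f x))) \o (fun h => h * a).
    apply/funext => h /=; rewrite !scalerA; congr (_ *: _).
    by rewrite invfM mulrCA mulfV// mulr1.
  apply: (@cvg_comp _ _ _ _ _ _ (0:R)^'); last exact: (cvgZl_tmp (k := a) fx).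
  move=> P; rewrite /dnbhs /= !near_simpl !near_withinE => P0.
  have ac : (fun h : R => h * a) @ (0 : R) --> (0 : R).
    by rewrite -[X in _ --> X](mul0r a); exact: mulrr_continuous.
  have : \forall h \near (0:R), h * a != 0 -> P (h * a).
    exact: (ac (fun y => y != 0 -> P y) P0).
  by apply: filterS => h Ph h0; apply: Ph; rewrite mulf_neq0.
by apply: DeriveDef; [apply/cvg_ex; eexists; exact: H | exact: cvg_lim H].
Qed.

(** Additivity in the direction without Frechet differentiability: on the segment from [x + h u] to
    [x + h (u + v)] the mean value theorem yields a value of the [v]-derivative at a nearby point,
    and that derivative is continuous at [x]. *)
Lemma derivable_deriveDv (R : realType) (V : normedModType R) (f : V -> R)
    (x u v : V) :
  (\forall y \near x, derivable f y v) ->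
  {for x, continuous (fun y => 'D_v f y)} -> derivable f x u ->
  is_derive x (u + v) f ('D_u f x + 'D_v f x).
Proof.
move=> fv cv fu.
pose g1 h := h^-1 *: (f (h *: u + x) - f x).
pose g2 h := h^-1 *: (f (h *: (u + v) + x) - f (h *: u + x)).
have H2 : g2 h @[h --> (0 : R)^'] --> 'D_v f x.
  apply/cvgrPdist_le => e e0.
  have : \forall y \near x, derivable f y v /\ `|'D_v f x - 'D_v f y| <= e.
    apply: filterI => //; move/cvgrPdist_le : cv; exact.
  move=> /nbhs_ballP[r /= r0 xr].
  (* With [h] below [r] divided by this number the whole segment lies in the ball of radius [r]; the
     added 1 keeps the divisor positive. *)
  have K0 : 0 < `|u| + `|v| + 1 by rewrite ltr_wpDl// addr_ge0.
  have small : \forall h \near (0 : R)^', `|h| < r / (`|u| + `|v| + 1).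
    by apply: dnbhs0_lt; rewrite divr_gt0.
  near=> h.
  have h0 : h != 0 by near: h; exact: nbhs_dnbhs_neq.
  have hr : `|h| < r / (`|u| + `|v| + 1) by near: h.
  have inb (t : R) : t \in `[0, 1]%R -> ball x r (t *: (h *: v) + (h *: u + x)).
    rewrite in_itv /= => /andP[t0 t1].
    rewrite -ball_normE /=.
    have -> : x - (t *: (h *: v) + (h *: u + x)) = - (t *: (h *: v) + h *: u).
      by rewrite addrA opprD addrCA subrr addr0.
    move: hr; rewrite ltr_pdivlMr// => hr; rewrite normrN (le_lt_trans _ hr)//.
    rewrite (le_trans (ler_normD _ _))// !normrZ (ger0_norm t0) mulrA.
    have := ler_wpM2r (mulr_ge0 (normr_ge0 h) (normr_ge0 v)) t1.
    by have := normr_ge0 h; rewrite -mulrA; lra.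
  pose k t := f (t *: (h *: v) + (h *: u + x)).
  have kd (t : R) : t \in `[0, 1]%R ->
      is_derive t 1 k (h *: 'D_v f (t *: (h *: v) + (h *: u + x))).
    by move=> t01; apply: is_derive_line; apply: is_deriveZv; case: (xr _ (inb t t01)).
  pose dk (t : R) := h *: 'D_v f (t *: (h *: v) + (h *: u + x)).
  have kdo (t : R) : t \in `]0, 1[%R -> is_derive t 1 k (dk t).
    by move=> /subset_itv_oo_cc; exact: kd.
  have kc : {within `[0, 1], continuous k}.
    by apply: derivable_within_continuous => t t01; case: (kd t t01).
  have [c c01 kcE] := MVT (@ltr01 R) kdo kc.
  have -> : g2 h = 'D_v f (c *: (h *: v) + (h *: u + x)).
    rewrite /g2; move: kcE; rewrite /dk /k scale0r add0r scale1r subr0 mulr1.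
    by rewrite [h *: (u + v)]scalerDr [h *: u + h *: v]addrC -addrA => ->; rewrite scalerK.
  by have [] := xr _ (inb c (subset_itv_oo_cc c01)).
have H : (fun h : R => h^-1 *: ((f \o shift x) (h *: (u + v)) - f x)) @ 0^'
          --> 'D_u f x + 'D_v f x.
  have -> : (fun h : R => h^-1 *: ((f \o shift x) (h *: (u + v)) - f x)) = g1 + g2.
    apply/funext => h; rewrite -[RHS]/(g1 h + g2 h) /g1 /g2 -scalerDr; congr (_ *: _).
    by rewrite /= [RHS]addrC addrA subrK.
  exact: cvgD.
by apply: DeriveDef; [apply/cvg_ex; eexists; exact: H | exact: cvg_lim H].
Unshelve. all: by end_near. Qed.

Lemma Ck_onW (R : realType) (V W : normedModType R) (k : nat) (U : set V)
    (f : V -> W) : Ck_on k.+1 U f -> Ck_on k U f.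
Proof.
elim: k f => [|k IHk] f [cf df]; split=> // v.
by have [dfv /IHk] := df v.
Qed.

Lemma near_eq_continuous (R : realType) (V W : normedModType R) (f g : V -> W)
    (x : V) : (\near x, f x = g x) -> {for x, continuous f} -> {for x, continuous g}.
Proof.
move=> fg cf; have fgx : f x = g x by exact: (nbhs_singleton fg).
have : g @ x --> f x by apply: cvg_trans cf; apply: near_eq_cvg.
by rewrite fgx.
Qed.

Lemma Ck_on_eq (R : realType) (V W : normedModType R) (k : nat) (U : set V)
    (f g : V -> W) : open U -> (forall x, U x -> f x = g x) ->
  Ck_on k U f -> Ck_on k U g.
Proof.
move=> oU; elim: k f g => [|k IHk] f g fg [cf df];
  have near_fg x : U x -> \near x, f x = g x by
    (move=> Ux; apply: filterS (open_nbhs_nbhs (conj oU Ux)) => y; exact: fg).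
- by split=> // x Ux; exact: near_eq_continuous (near_fg x Ux) (cf x Ux).
- split=> [x Ux|v]; first exact: near_eq_continuous (near_fg x Ux) (cf x Ux).
  have [dfv Cfv] := df v; split=> [x Ux|].
    exact: near_eq_derivable (near_fg x Ux) (dfv x Ux).
  by apply: IHk Cfv => x Ux; apply: near_eq_derive; exact: near_fg.
Qed.

Lemma Ck_on_coord (R : realType) (V : normedModType R) (p q k : nat) (U : set V)
    (F : V -> 'M[R]_(p, q)) (i : 'I_p) (j : 'I_q) : open U -> Ck_on k U F ->
  Ck_on k U (fun x => F x i j).
Proof.
move=> oU; elim: k F => [|k IHk] F [cF dF].
  split=> // x Ux; apply: (@continuous_comp _ _ _ F (fun M => M i j)).
    exact: cF.
  exact: coord_continuous.
split=> [x Ux|v].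
  apply: (@continuous_comp _ _ _ F (fun M => M i j)).
    exact: cF.
  exact: coord_continuous.
have [dFv CFv] := dF v; split=> [x Ux|].
  by have /derivable_mxP := dFv x Ux.
apply: Ck_on_eq (IHk _ CFv) => // x Ux.
by rewrite derive_mx ?mxE//; exact: dFv.
Qed.

Lemma derive_coord (R : realType) (V : normedModType R) (p q : nat)
    (F : V -> 'M[R]_(p, q)) (x v : V) (i : 'I_p) (j : 'I_q) :
  derivable F x v -> 'D_v (fun y => F y i j) x = 'D_v F x i j.
Proof. by move=> dF; rewrite derive_mx// mxE. Qed.

(** [Ck_on] speaks only of directional derivatives, so linearity in the direction needs an argument:
    the basis expansion of [v] is built up one term at a time, each step resting on the continuity
    of the new directional derivative. *)
Lemma C1_derive_lin (R : realType) (m : nat) (U : set 'rV[R]_m)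
    (f : 'rV[R]_m -> R) (x v : 'rV[R]_m) : open U -> U x -> Ck_on 1 U f ->
  'D_v f x = \sum_a v 0 a * 'D_(delta_mx 0 a) f x.
Proof.
move=> oU Ux [_ Cf]; have nU := open_nbhs_nbhs (conj oU Ux).
have df y w : U y -> derivable f y w by case: (Cf w) => + _; apply.
have cf w : U x -> {for x, continuous (fun y => 'D_w f y)}.
  by case: (Cf w) => _ [+ _]; apply.
rewrite [in LHS](row_sum_delta v).
elim/big_ind2: _ => [|a u b w <- <-|a _].
- by rewrite derive0.
- have fw : \forall y \near x, derivable f y w.
    by apply: filterS nU => y Uy; exact: df.
  by have [_ ->] := derivable_deriveDv fw (cf w Ux) (df x u Ux).
- by have [_ ->] := is_deriveZv (v 0 a) (df x (delta_mx 0 a) Ux).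
Qed.

(** Everything happens on the line through [x] along [v]. If the second derivative were positive,
    [g'], which vanishes at 0, would be positive just to the right of 0, and the mean value theorem
    would give a value of [g] above its maximum. *)
Lemma second_derivative_test (R : realType) (V : normedModType R) (f : V -> R)
    (x v : V) :
  (\forall y \near x, f y <= f x) -> (\forall y \near x, derivable f y v) ->
  derivable (fun y => 'D_v f y) x v ->
  'D_v f x = 0 /\ 'D_v (fun y => 'D_v f y) x <= 0.
Proof.
move=> /(near_line v) fmax /(near_line v) fd dfd.
pose g (t : R) : R := f (t *: v + x); pose g' (t : R) : R := 'D_v f (t *: v + x).
have [r r0 Hr] : exists2 r : R, 0 < r & forall t, `|t| < r ->
    g t <= f x /\ derivable f (t *: v + x) v.
  have : \forall t \near (0 : R), g t <= f x /\ derivable f (t *: v + x) v.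
    exact: filterI.
  move=> /nbhs_ballP[r /= r0 Hr]; exists r => // t tr.
  by apply: Hr; rewrite -ball_normE /= sub0r normrN.
have gd (t : R) : `|t| < r -> is_derive t 1 g (g' t).
  by move=> /Hr[_ ?]; apply: is_derive_line; exact: derivableP.
have g0 : g 0 = f x by rewrite /g scale0r add0r.
have g'0 : g' 0 = 'D_v f x by rewrite /g' scale0r add0r.
have inr (t : R) : t \in `](- r), r[%R -> `|t| < r.
  by rewrite in_itv /= ltr_norml.
have max0 : 'D_v f x = 0.
  have r0' : 0 \in `](- r), r[%R by rewrite in_itv /= oppr_lt0 r0.
  have rr : - r <= r by rewrite (@le_trans _ _ 0)// ?oppr_le0 ltW.
  have [] := @derive1_at_max _ g (- r) r 0 rr _ r0' _.
  - by move=> t /inr/gd[].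
  - by move=> t /inr/Hr[]; rewrite g0.
  have [_ ->] := gd 0 (inr _ r0').
  by rewrite g'0.
split=> //; rewrite leNgt; apply/negP => D2.
have g'd : is_derive (0 : R) (1 : R) g' ('D_v (fun y => 'D_v f y) x).
  apply: (@is_derive_line _ _ _ (fun y => 'D_v f y) x v 0).
  by rewrite scale0r add0r; exact: derivableP.
set c := 'D_v _ x in D2 g'd.
have : \forall t \near (0 : R)^'+, 0 < t^-1 *: (g' (t *: 1 + 0) - g' 0).
  apply: near_dnbhs_right; case: g'd => g'd g'c.
  have H : (fun h : R => h^-1 *: (g' (h *: 1 + 0) - g' 0)) @ (0 : R)^' --> c.
    by rewrite -g'c; exact: g'd.
  exact: (cvgr_gt _ H).
rewrite near_withinE => /nbhs_ballP[s /= s0 Hs].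
(* Halving puts [b] strictly inside both ranges: [r], where the maximum and the derivatives are
   controlled, and [s], where the quotient of [g'] is positive. *)
pose b := Num.min r s / 2.
have b0 : 0 < b by rewrite divr_gt0// lt_min r0.
have bm : b < Num.min r s by rewrite /b ltr_pdivrMr// mulr_natr mulr2n ltrDl lt_min r0.
move: bm; rewrite lt_min => /andP[br bs].
have tb (t : R) : t \in `[0, b]%R -> `|t| < r.
  by rewrite in_itv /= => /andP[t0 t1]; rewrite ger0_norm// (le_lt_trans t1).
have gc : {within `[0, b], continuous g}.
  by apply: derivable_within_continuous => t /tb/gd[].
have [c1 c1b gE] := @MVT _ g g' 0 b b0
  (fun (t : R) tb0 => gd t (tb t (subset_itv_oo_cc tb0))) gc.
have : 0 < g' c1.
  move: c1b; rewrite in_itv /= => /andP[c0 cb].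
  have := Hs c1; rewrite -ball_normE /= sub0r normrN gtr0_norm//.
  move=> /(_ (lt_trans cb bs) c0).
  rewrite [c1 *: 1]mulr1 addr0 g'0 max0 subr0 pmulr_rgt0// invr_gt0//.
have := (Hr b _).1; rewrite gtr0_norm// => /(_ br).
rewrite -g0 -subr_le0 gE subr0 => gb g'c1.
by move: gb; rewrite pmulr_lle0// leNgt g'c1.
Qed.

Lemma is_derive_pointwise_sum (R : realType) (V : normedModType R) (n : nat)
    (h : 'I_n -> V -> R) (x v : V) (dh : 'I_n -> R) :
  (forall i, is_derive x v (h i) (dh i)) ->
  is_derive x v (fun y => \sum_(i < n) h i y) (\sum_(i < n) dh i).
Proof.
move=> hd; have -> : (fun y => \sum_(i < n) h i y) = \sum_(i < n) h i.
  by apply/funext => y; rewrite fct_sumE.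
exact: is_derive_sum.
Qed.

(** * First and second order conditions at a maximum of a diagonal quadratic function *)

Section QuadraticMaximum.
Context (R : realType) (m e : nat) (U : set 'rV[R]_m) (x : 'rV[R]_m)
  (F : 'rV[R]_m -> 'rV[R]_e) (q : 'rV[R]_e).
Context (oU : open U) (Ux : U x) (CF : Ck_on 2 U F).

(** The [w]-th coordinate vector field is differentiated along [u], in this order, to match the
    derivative along [u] of the orthogonality between the normal and that field. *)
Definition second_derivative (u w : 'I_m) (b : 'I_e) : R :=
  'D_(delta_mx 0 u) (fun y => 'D_(delta_mx 0 w) F y 0 b) x.

Let phi y := \sum_b q 0 b * F y 0 b ^+ 2.
Let J : 'M_(m, e) := \matrix_(u, b) 'D_(delta_mx 0 u) F x 0 b.
Let K : 'M_m := \matrix_(u, w) \sum_b (F x *m diag_mx q) 0 b * second_derivative u w b.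

Let CFb b : Ck_on 2 U (fun y => F y 0 b). Proof. exact: Ck_on_coord. Qed.

Let dF y v : U y -> derivable F y v.
Proof. by case: CF => _ /(_ v) [+ _]; apply. Qed.

Let dFb y v b : U y -> is_derive y v (fun y => F y 0 b) ('D_v F y 0 b).
Proof.
move=> Uy; rewrite -derive_coord; last exact: dF.
by apply: derivableP; case: (CFb b) => _ /(_ v) [+ _]; apply.
Qed.

Let CdF v b : Ck_on 1 U (fun y => 'D_v F y 0 b).
Proof. by case: CF => _ /(_ v) [_ CFv]; exact: Ck_on_coord. Qed.

Let ddF y u v b : U y -> derivable (fun y => 'D_v F y 0 b) y u.
Proof. by case: (CdF v b) => _ /(_ u) [+ _]; apply. Qed.

Lemma derive_lin_coord y v b : U y ->
  'D_v F y 0 b = \sum_a v 0 a * 'D_(delta_mx 0 a) F y 0 b.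
Proof.
move=> Uy; have [_ <-] := dFb v b Uy.
rewrite (C1_derive_lin _ oU Uy (Ck_onW (CFb b))).
by apply: eq_bigr => a _; have [_ ->] := dFb (delta_mx 0 a) b Uy.
Qed.

(** The expansion in the inner direction is used on a whole neighborhood of [x], since it is
    differentiated once more. *)
Lemma second_derive_lin v b :
  'D_v (fun y => 'D_v F y 0 b) x =
  \sum_u \sum_w v 0 u * v 0 w * second_derivative u w b.
Proof.
rewrite (C1_derive_lin _ oU Ux (CdF v b)); apply: eq_bigr => u _.
have -> : 'D_(delta_mx 0 u) (fun y => 'D_v F y 0 b) x =
    'D_(delta_mx 0 u) (fun y => \sum_w v 0 w * 'D_(delta_mx 0 w) F y 0 b) x.
  apply: near_eq_derive; apply: filterS (open_nbhs_nbhs (conj oU Ux)) => y Uy.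
  exact: derive_lin_coord.
have [_ ->] := @is_derive_pointwise_sum _ _ _
  (fun w y => v 0 w * 'D_(delta_mx 0 w) F y 0 b) x (delta_mx 0 u)
  (fun w => v 0 w * second_derivative u w b)
  (fun w => is_deriveZ (v 0 w) (derivableP (@ddF x (delta_mx 0 u) (delta_mx 0 w) b Ux))).
by rewrite mulr_sumr; apply: eq_bigr => w _; rewrite mulrA.
Qed.

Let dphi y v : U y ->
  is_derive y v phi (\sum_b (2 * q 0 b) * (F y 0 b * 'D_v F y 0 b)).
Proof.
move=> Uy; apply: is_derive_pointwise_sum => b.
have -> : (fun y => q 0 b * F y 0 b ^+ 2) =
    q 0 b *: ((fun y => F y 0 b) * (fun y => F y 0 b)).
  by apply/funext => z; rewrite expr2.
apply: is_derive_eq (is_deriveZ (q 0 b) (is_deriveM (dFb v b Uy) (dFb v b Uy))) _.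
by rewrite /GRing.scale /=; ring.
Qed.

(** These are the first and second order conditions for [phi], divided by 2. In half the Hessian,
    [J *m diag_mx q *m J^T] collects the products of first derivatives and [K] the second
    derivatives of [F]. *)
Lemma quadratic_max : (\forall y \near x, phi y <= phi x) ->
  J *m (F x *m diag_mx q)^T = 0 /\
  forall v : 'rV_m, (v *m (J *m diag_mx q *m J^T + K) *m v^T) 0 0 <= 0.
Proof.
move=> phimax; have nU := open_nbhs_nbhs (conj oU Ux).
pose d v y := \sum_b (2 * q 0 b) * (F y 0 b * 'D_v F y 0 b).
pose d2 v := \sum_b (2 * q 0 b) * ('D_v F x 0 b ^+ 2 +
   F x 0 b * 'D_v (fun y => 'D_v F y 0 b) x).
have dd v : is_derive x v (d v) (d2 v).
  apply: is_derive_pointwise_sum => b.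
  have -> : (fun y => 2 * q 0 b * (F y 0 b * 'D_v F y 0 b)) =
      (2 * q 0 b) *: ((fun y => F y 0 b) * (fun y => 'D_v F y 0 b)) by [].
  apply: is_derive_eq (is_deriveZ (2 * q 0 b)
    (is_deriveM (dFb v b Ux) (derivableP (@ddF x v v b Ux)))) _.
  by rewrite /GRing.scale /=; ring.
have nd v : \near x, 'D_v phi x = d v x.
  by apply: filterS nU => y Uy; have [_ ->] := dphi v Uy.
have key v : d v x = 0 /\ d2 v <= 0.
  have [] := @second_derivative_test _ _ phi x v phimax.
  - by apply: filterS nU => y Uy; case: (dphi v Uy).
  - have [+ _] := dd v; apply: near_eq_derivable.
    by apply: filterS (nd v) => y ->.
  rewrite (near_eq_derive v (nd v)); have [_ ->] := dd v.
  by have [_ ->] := dphi v Ux.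
split.
  apply/matrixP => u j; rewrite [j]ord1 !mxE.
  have [d0 _] := key (delta_mx 0 u).
  have : 2 * (\sum_b q 0 b * (F x 0 b * 'D_(delta_mx 0 u) F x 0 b)) = 0.
    by rewrite -[RHS]d0 /d mulr_sumr; apply: eq_bigr => b _; rewrite mulrA.
  move/eqP; rewrite mulf_eq0 pnatr_eq0 /= => /eqP d0'; rewrite -[RHS]d0'.
  by apply: eq_bigr => b _; rewrite mul_mx_diag !mxE; ring.
move=> v; have [_] := key v.
have vJ b : (v *m J) 0 b = 'D_v F x 0 b.
  by rewrite derive_lin_coord// mxE; apply: eq_bigr => a _; rewrite mxE.
have -> : d2 v = 2 * (v *m (J *m diag_mx q *m J^T + K) *m v^T) 0 0.
  rewrite mulmxDr mulmxDl mxE mulrDr !mulmxA -(mulmxA _ J^T) -trmx_mul.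
  have -> : d2 v = 2 * (\sum_b q 0 b * (v *m J) 0 b ^+ 2) +
    2 * (\sum_b q 0 b * F x 0 b * 'D_v (fun y => 'D_v F y 0 b) x).
    rewrite !mulr_sumr -big_split /=; apply: eq_bigr => b _; rewrite vJ; ring.
  congr (_ * _ + _ * _).
    rewrite [RHS]mxE; apply: eq_bigr => b _.
    by move: (v *m J) => w; rewrite mul_mx_diag !mxE; ring.
  transitivity (\sum_w \sum_u \sum_b
      v 0 u * v 0 w * (q 0 b * F x 0 b * second_derivative u w b)).
    rewrite [RHS]exchange_big /=.
    under [RHS]eq_bigr do rewrite exchange_big /=.
    rewrite [RHS]exchange_big /=; apply: eq_bigr => b _.
    rewrite second_derive_lin mulr_sumr; apply: eq_bigr => u _.
    by rewrite mulr_sumr; apply: eq_bigr => w _; ring.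
  rewrite [RHS]mxE; apply: eq_bigr => w _; rewrite !mxE mulr_suml.
  apply: eq_bigr => u _; rewrite mxE mulr_sumr mulr_suml; apply: eq_bigr => b _.
  by rewrite mul_mx_diag mxE; ring.
by rewrite pmulr_rle0.
Qed.
End QuadraticMaximum.

(** * Hypersurface charts and tangent vectors at the vertex *)

(** Tangency to the wall is allowed, so every coordinate vector qualifies and, for any [v], at least
    one of [v] and [- v] does. *)
Definition inward (R : realType) (e : nat) (w : option 'I_e) (v : 'rV[R]_e) : Prop :=
  forall a, w = Some a -> 0 <= v 0 a.

Lemma inward_delta (R : realType) (e : nat) (w : option 'I_e) (a : 'I_e) :
  inward w (delta_mx 0 a : 'rV[R]_e).
Proof. by move=> b _; rewrite mxE eqxx /= ler0n. Qed.

Lemma inwardVN (R : realType) (e : nat) (w : option 'I_e) (v : 'rV[R]_e) :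
  inward w v \/ inward w (- v).
Proof.
case: w => [a|]; last by left.
have [v0|v0] := leP 0 (v 0 a); [left|right] => b [<-] //.
by rewrite mxE oppr_ge0 ltW.
Qed.

Lemma near_inward (R : realType) (e : nat) (w : option 'I_e) (A : set 'rV[R]_e)
    (x v : 'rV[R]_e) : model_space w x -> inward w v ->
  (\forall y \near x, model_space w y -> A y) ->
  \forall h \near (0 : R)^'+, A (h *: v + x).
Proof.
move=> wx wv /(near_line v); rewrite near_withinE; apply: filterS => h hA h0.
apply: hA; case: w wx wv => [a|] //= xa va.
by rewrite mxE addr_ge0// mxE mulr_ge0 ?va// ltW.
Qed.

(** This covers wall points too: coordinate vectors are inward, so small positive increments stay in
    [A], and they suffice to recover the derivatives of the extension [F]. *)
Lemma jacobian_inE (R : realType) (m e : nat) (w : option 'I_m)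
    (A : set 'rV[R]_m) (f F : 'rV[R]_m -> 'rV[R]_e) (U : set 'rV[R]_m)
    (x : 'rV[R]_m) :
  A x -> model_space w x -> (\forall y \near x, model_space w y -> A y) ->
  open U -> U x -> (forall y, U y -> A y -> f y = F y) -> Ck_on 1 U F ->
  jacobian_in A f x = \matrix_(a, b) 'D_(delta_mx 0 a) F x 0 b.
Proof.
move=> Ax wx nA oU Ux fF [_ CF]; apply/matrixP => a b; rewrite !mxE.
rewrite /partial_in (derive_inE (F := F))//.
- exact: near_inward wx (inward_delta _ a) nA.
- by apply: filterS (open_nbhs_nbhs (conj oU Ux)) => y Uy; exact: fF.
- by case: (CF (delta_mx 0 a)) => + _; apply.
Qed.

(** Continuity of [cinv c] keeps the images of nearby coordinates in the open ambient chart domain.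
    At a wall point this yields only a relative neighborhood, whence the restriction to
    [model_space]. *)
Lemma hs_dom_near (R : realType) (T : topologicalType) (e : nat)
    (D : metric_atlas R T e) (S : set T) (c : chart R T e.-1)
    (i : chart_index D) (p : T) :
  chart_on S c -> open (cdom (chart_at i)) -> cdom c p -> cdom (chart_at i) p ->
  \forall y \near cfun c p, model_space (wall c) y -> hs_dom c i y.
Proof.
move=> [_ [O oO cO] cK _ cc] oi cp ip.
have imp : cimg c (cfun c p) by exists p.
have Op : O (cfun c p) by move: imp; rewrite cO => -[].
have near_i : \forall y \near cfun c p, cimg c y -> cdom (chart_at i) (cinv c y).
  have : cinv c @ within (cimg c) (nbhs (cfun c p)) --> p.
    by rewrite -[X in _ --> X](cK p cp); move/subspace_continuousP : cc; exact.
  move=> /(_ (cdom (chart_at i))); rewrite /= near_simpl; apply.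
  exact: open_nbhs_nbhs.
apply: filterS2 (open_nbhs_nbhs (conj oO Op)) near_i => y Oy iy wy.
have : cimg c y by rewrite cO.
move=> cy; have := iy cy; case: cy => r cr <-; rewrite cK// => ir.
by exists r.
Qed.

Lemma hs_domK (R : realType) (T : topologicalType) (e : nat)
    (D : metric_atlas R T e) (S : set T) (c : chart R T e.-1)
    (i : chart_index D) (y : 'rV[R]_e.-1) :
  chart_on S c -> hs_dom c i y ->
  [/\ cdom c (cinv c y), cdom (chart_at i) (cinv c y), cfun c (cinv c y) = y,
      S (cinv c y) & model_space (wall c) y].
Proof.
move=> [[O1 _ cS] [O2 _ cO] cK _ _] [r [cr ir] <-]; rewrite cK//; split=> //.
  by move: cr; rewrite cS => -[].
have : cimg c (cfun c r) by exists r.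
by rewrite cO => -[].
Qed.

Definition t_index (n q : nat) (a : 'I_q) : 'I_(n + q + 1) := lshift 1 (rshift n a).
Definition s_index (n q : nat) : 'I_(n + q + 1) := rshift (n + q) 0.

Lemma prod_coord_t (R : realType) (n q : nat) (x : 'rV[R]_n) (t : 'rV[R]_q) (s : R) a :
  prod_coord x t s 0 (t_index n a) = t 0 a.
Proof. by rewrite /prod_coord row_mxEl row_mxEr. Qed.

Lemma prod_coord_s (R : realType) (n q : nat) (x : 'rV[R]_n) (t : 'rV[R]_q) (s : R) :
  prod_coord x t s 0 (s_index n q) = s.
Proof. by rewrite /prod_coord row_mxEr mxE eqxx. Qed.

Lemma sqr_eucl_norm (R : realType) (m : nat) (t : 'rV[R]_m) :
  eucl_norm t ^+ 2 = \sum_(a < m) t 0 a ^+ 2.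
Proof. by rewrite sqr_sqrtr// sumr_ge0// => a _; exact: sqr_ge0. Qed.

Section Vertex.
Context (R : realType) (M : topologicalType) (n q : nat) (D : metric_atlas R M n).
Context (hM : riemannian_manifold D).
Let P := prod_atlas q D.

Lemma prod_cdom_open (i : chart_index P) : open (cdom (chart_at i)).
Proof.
have [[O oO cO] _ _ _ _] := rm_chart hM i.
rewrite (_ : cdom _ = (fun z : M * 'rV[R]_q * R => z.1.1) @^-1` O).
  apply: open_comp => // z _.
  by apply: (@continuous_comp _ _ _ fst fst); exact: cvg_fst.
by rewrite /= cO setTI.
Qed.

Lemma prod_cover (z : M * 'rV[R]_q * R) : exists i : chart_index P, cdom (chart_at i) z.
Proof. by have [i iz] := rm_cover hM z.1.1; exists i. Qed.

(** Along the ray from the vertex in direction [v], each point satisfies [t_a^2 <= |t|^2 <= s^2].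
    Both coordinates vanish at the start, so dividing by the squared increment and letting it tend
    to 0 from the right gives the inequality for the derivatives. *)
Lemma tangent_in_cone (S : set (M * 'rV[R]_q * R)) (c : chart R _ (n + q + 1).-1)
    (i : chart_index P) (p : M * 'rV[R]_q * R) (v : 'rV[R]_(n + q + 1).-1) (a : 'I_q) :
  hypersurface_chart P S c -> cdom c p -> cdom (chart_at i) p ->
  (forall z, S z -> rho z <= 0) -> p.1.2 = 0 -> p.2 = 0 -> inward (wall c) v ->
  (v *m hs_jacobian c i p) 0 (t_index n a) ^+ 2 <=
  (v *m hs_jacobian c i p) 0 (s_index n q) ^+ 2.
Proof.
move=> [cS smoothX _] cp ip Srho pt ps wv.
set x := cfun c p; set X := cfun (chart_at i) \o cinv c.
have Ax : hs_dom c i x by exists p.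
have [_ _ _ _ wx] := hs_domK cS Ax.
have nA := hs_dom_near cS (@prod_cdom_open i) cp ip.
have [U [F [oU Ux CF XF]]] := smoothX i x Ax.
have jE : hs_jacobian c i p = \matrix_(a, b) 'D_(delta_mx 0 a) F x 0 b.
  exact: jacobian_inE Ax wx nA oU Ux XF (CF 1%N).
have vJ b : (v *m hs_jacobian c i p) 0 b = 'D_v F x 0 b.
  rewrite (derive_lin_coord oU (CF 2%N) v b Ux) jE mxE.
  by apply: eq_bigr => u _; rewrite mxE.
rewrite !vJ.
have cvgF b : h^-1 * (F (h *: v + x) 0 b - F x 0 b) @[h --> (0 : R)^'+] --> 'D_v F x 0 b.
  have Fv : derivable F x v by case: (CF 1%N) => _ /(_ v) [+ _]; apply.
  rewrite -derive_coord//; apply: cvg_dnbhs_at_right.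
  by have /derivable_mxP/(_ 0 b) := Fv.
have F0 b : F x 0 b = X x 0 b by rewrite -XF.
have Xt y (b : 'I_q) : hs_dom c i y -> X y 0 (t_index n b) = (cinv c y).1.2 0 b.
  by move=> _; rewrite /X /= prod_coord_t.
have Xs y : hs_dom c i y -> X y 0 (s_index n q) = (cinv c y).2.
  by move=> _; rewrite /X /= prod_coord_s.
have cx : cinv c x = p by case: cS => _ _ + _ _; apply.
have Ft0 : F x 0 (t_index n a) = 0 by rewrite F0 Xt// cx pt mxE.
have Fs0 : F x 0 (s_index n q) = 0 by rewrite F0 Xs// cx.
have ct := cvgM (cvgF (t_index n a)) (cvgF (t_index n a)).
have cs := cvgM (cvgF (s_index n q)) (cvgF (s_index n q)).
rewrite !expr2; apply: (ler_cvg_to (ct _) (cs _)).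
have := near_inward wx wv nA => nAv.
have nU : \forall h \near (0 : R)^'+, U (h *: v + x).
  rewrite near_withinE.
  by apply: filterS (near_line v (open_nbhs_nbhs (conj oU Ux))) => h Uh _.
near=> h.
have Ah : hs_dom c i (h *: v + x) by near: h.
have Uh : U (h *: v + x) by near: h.
rewrite /= Ft0 Fs0 !subr0 -!XF// Xt// Xs//.
have [_ _ _ Sh _] := hs_domK cS Ah.
have := Srho _ Sh; rewrite /rho subr_le0 sqr_eucl_norm.
set z := cinv c _; rewrite (bigD1 a)//= => le.
have {le} : z.1.2 0 a ^+ 2 <= z.2 ^+ 2.
  by apply: le_trans le; rewrite lerDl sumr_ge0// => b _; exact: sqr_ge0.
by rewrite -/z -!expr2 !exprMn => le; rewrite ler_wpM2l ?sqr_ge0.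
Unshelve. all: by end_near. Qed.

Lemma vertex_not_in_hypersurface (S : set (M * 'rV[R]_q * R)) (p : M * 'rV[R]_q * R) :
  (1 < q)%N -> hypersurface P S -> S p -> (forall z, S z -> rho z <= 0) ->
  p.2 != 0.
Proof.
move=> q1 Shyp Sp Srho; apply/eqP => ps.
have pt : p.1.2 = 0.
  have : eucl_norm p.1.2 ^+ 2 <= 0.
    by have := Srho p Sp; rewrite /rho ps expr0n subr0.
  rewrite sqr_eucl_norm => le0; apply/rowP => a; rewrite mxE.
  have : \sum_(b < q) p.1.2 0 b ^+ 2 = 0.
    by apply/le_anti; rewrite le0 sumr_ge0// => b _; exact: sqr_ge0.
  move/psumr_eq0P => /(_ (fun b _ => sqr_ge0 _) a isT) /eqP.
  by rewrite sqrf_eq0 => /eqP.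
have [c cS cp] := Shyp p Sp; have [i ip] := prod_cover p.
have [_ _ /(_ i p cp ip)] := cS.
set J := hs_jacobian c i p => J_free.
have cone (v : 'rV[R]_(n + q + 1).-1) : (v *m J) 0 (s_index n q) = 0 ->
    forall a, (v *m J) 0 (t_index n a) = 0.
  (* Either [v] or [- v] is inward, and the conclusion is insensitive to the sign. *)
  move=> vs a; have [wv|wv] := inwardVN (wall c) v.
    have := tangent_in_cone a cS cp ip Srho pt ps wv; rewrite -/J vs expr0n /=.
    by rewrite real_exprn_even_le0 ?num_real//= => /eqP.
  have := tangent_in_cone a cS cp ip Srho pt ps wv; rewrite -/J.
  have E b : (- v *m J) 0 b = - (v *m J) 0 b by rewrite mulNmx mxE.
  rewrite !E vs oppr0 expr0n sqrrN /=.
  by rewrite real_exprn_even_le0 ?num_real//= => /eqP.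
(* [J'] drops the [t]-columns: it has [n + q] rows and [n + 1] columns, so [1 < q] forces a nonzero
   kernel. *)
pose J' := row_mx (lsubmx (lsubmx J)) (rsubmx J).
have : kermx J' != 0.
  rewrite kermx_eq0 /row_free; apply/negP => /eqP rJ.
  have := rank_leq_col J'; rewrite rJ; lia.
case/rowV0Pn => v /sub_kermxP; rewrite /J' mul_mx_row => vJ0 v0.
have [vx vs] : v *m lsubmx (lsubmx J) = 0 /\ v *m rsubmx J = 0.
  by apply: eq_row_mx; rewrite vJ0 row_mx0.
move/negP: v0; apply; apply/eqP/(row_free_inj J_free); rewrite mul0mx.
have s0 : (v *m J) 0 (s_index n q) = 0.
  by move/matrixP: vs => /(_ 0 0); rewrite mulmx_rsub !mxE.
have t0 := cone v s0.
apply/rowP => b; rewrite [RHS]mxE.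
case: (split_ordP b) => [b' ->|b' ->]; last by rewrite [b']ord1.
case: (split_ordP b') => [b'' ->|a ->]; last exact: t0.
by move/matrixP: vx => /(_ 0 b''); rewrite !mulmx_lsub !mxE.
Qed.

End Vertex.

(** * The weighted product *)

Lemma cvg_finite_sum (R : realType) (T : Type) (F : set_system T) (FF : Filter F)
    (n : nat) (f : 'I_n -> T -> R) (l : 'I_n -> R) :
  (forall a, f a h @[h --> F] --> l a) ->
  \sum_a f a h @[h --> F] --> \sum_a l a.
Proof. by move=> fl; apply: cvg_big => //; exact: add_continuous. Qed.

(** In the application [X] is a coordinate vector field of the hypersurface. The product rule has no
    term in the derivative of [G], because [lam *: nu x *m G y] equals the fixed vector [V] for all
    [y] near [x]; continuity of [G] therefore suffices. *)
Lemma normal_derivative (R : realType) (m e : nat) (x u : 'rV[R]_m)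
    (nu : 'rV[R]_m -> 'rV[R]_e) (G : 'rV[R]_m -> 'M[R]_e) (X : 'rV[R]_m -> 'rV[R]_e)
    (V : 'rV[R]_e) (lam : R) :
  (\forall y \near x, (nu y *m G y *m (X y)^T) 0 0 = 0) ->
  (\forall y \near x, V *m G y = V) -> V = lam *: nu x ->
  derivable nu x u -> (forall b, derivable (fun y => X y 0 b) x u) ->
  (forall b, {for x, continuous (fun y => X y 0 b)}) ->
  (forall a b, {for x, continuous (fun y => G y a b)}) ->
  lam * ('D_u nu x *m G x *m (X x)^T) 0 0 =
    - \sum_b V 0 b * 'D_u (fun y => X y 0 b) x.
Proof.
move=> orth VG Vnu dnu dX cX cG.
have mulE (A B : 'rV[R]_e) (C : 'M[R]_e) :
    (A *m C *m B^T) 0 0 = \sum_a A 0 a * (\sum_b C a b * B 0 b).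
  rewrite -mulmxA mxE; apply: eq_bigr => a _; rewrite mxE; congr (_ * _).
  by apply: eq_bigr => b _; rewrite mxE.
pose y (h : R) := h *: u + x.
have cy : y h @[h --> (0 : R)^'] --> x.
  have : y h @[h --> (0 : R)] --> x.
    have -> : x = y 0 by rewrite /y scale0r add0r.
    exact: line_continuous.
  by apply: cvg_trans; apply: cvg_app; exact: cvg_within.
(* This is the difference quotient of the vanishing function [lam <nu, X>], regrouped with
   [lam *: nu x *m G] replaced by [V]. *)
pose Q (h : R) := lam * (\sum_a (h^-1 * (nu (y h) 0 a - nu x 0 a)) *
                    (\sum_b G (y h) a b * X (y h) 0 b)) +
                  \sum_b V 0 b * (h^-1 * (X (y h) 0 b - X x 0 b)).
have Qlim : Q h @[h --> (0 : R)^'] --> lam * ('D_u nu x *m G x *m (X x)^T) 0 0 +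
    \sum_b V 0 b * 'D_u (fun y => X y 0 b) x.
  rewrite mulE; apply: cvgD.
    apply: cvgMl_tmp; apply: cvg_finite_sum => a; apply: cvgM.
      rewrite -derive_coord//; have /derivable_mxP/(_ 0 a) := dnu; exact.
    apply: cvg_finite_sum => b; apply: cvgM.
      exact: cvg_comp cy (cG a b).
    exact: cvg_comp cy (cX b).
  by apply: cvg_finite_sum => b; apply: cvgMl_tmp; exact: dX.
have Q0 : \forall h \near (0 : R)^', Q h = 0.
  near=> h.
  have oy : (nu (y h) *m G (y h) *m (X (y h))^T) 0 0 = 0.
    by near: h; exact: nbhs_dnbhs (near_line u orth).
  have Vy : V *m G (y h) = V by near: h; exact: nbhs_dnbhs (near_line u VG).
  have VX : (V *m (X (y h))^T) 0 0 = lam * \sum_a nu x 0 a * (\sum_b G (y h) a b * X (y h) 0 b).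
    rewrite -Vy mulE Vnu mulr_sumr; apply: eq_bigr => a _.
    by rewrite mxE mulrA.
  have VX0 : (V *m (X x)^T) 0 0 = 0.
    rewrite -(nbhs_singleton VG) Vnu -!scalemxAl mxE.
    by rewrite (nbhs_singleton orth) mulr0.
  have -> : Q h = h^-1 * (lam * (nu (y h) *m G (y h) *m (X (y h))^T) 0 0 -
     (V *m (X x)^T) 0 0).
    transitivity (h^-1 * (lam * (nu (y h) *m G (y h) *m (X (y h))^T) 0 0 -
      lam * (\sum_a nu x 0 a * (\sum_b G (y h) a b * X (y h) 0 b)) +
     ((V *m (X (y h))^T) 0 0 - (V *m (X x)^T) 0 0))).
      rewrite mulE -mulrBr -sumrB mulrDr; congr (_ + _).
        rewrite mulrCA; congr (_ * _); rewrite mulr_sumr.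
        by apply: eq_bigr => a _; rewrite -mulrBl mulrA.
      rewrite [(V *m (X (y h))^T) 0 0]mxE [(V *m (X x)^T) 0 0]mxE -sumrB mulr_sumr.
      by apply: eq_bigr => b _; rewrite !mxE; ring.
    by rewrite VX; ring.
  by rewrite oy VX0 mulr0 subr0 mulr0.
have Q00 : Q h @[h --> (0 : R)^'] --> (0 : R) by exact: cvg_near_cst.
by apply/eqP; rewrite -addr_eq0; apply/eqP; exact: norm_cvg_unique Qlim Q00.
Unshelve. all: by end_near. Qed.

Definition base_index (n q : nat) (a : 'I_n) : 'I_(n + q + 1) := lshift 1 (lshift q a).

Lemma prod_indexP (n q : nat) (b : 'I_(n + q + 1)) :
  [\/ exists a, b = base_index q a, exists a, b = t_index n a | b = s_index n q].
Proof.
case: (split_ordP b) => [b' ->|b' ->]; last by rewrite [b']ord1; apply: Or33.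
by case: (split_ordP b') => [a ->|a ->]; [apply: Or31|apply: Or32]; exists a.
Qed.

(** These are the directions of the Euclidean factor, in which the product metric is flat. *)
Definition fiber_index (n q : nat) (b : 'I_(n + q + 1)) : Prop :=
  (exists a, b = t_index n a) \/ b = s_index n q.

Lemma sum_prod_index (V : nmodType) (n q : nat) (f : 'I_(n + q + 1) -> V) :
  \sum_b f b = \sum_a f (base_index q a) + \sum_a f (t_index n a) + f (s_index n q).
Proof. by rewrite big_split_ord big_split_ord /= big_ord1. Qed.

Lemma derive_in_constant (R : realType) (V W : normedModType R) (A : set V)
    (f : V -> W) (x v : V) :
  (\forall h \near (0 : R)^'+, A (h *: v + x)) ->
  (forall h : R, A (h *: v + x) -> f (h *: v + x) = f x) ->
  derive_in A f x v = 0.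
Proof.
move=> Ax fx; have pf := within_line_proper Ax.
apply: cvg_lim => //; apply: cvg_near_cst; rewrite near_withinE.
by near=> h => Ah; rewrite fx// subrr scaler0.
Unshelve. all: by end_near. Qed.

Section Weights.
Context (R : realType) (n q : nat).

(* Half the Hessian of (1 + eps) |t|^2 - s^2 *)
Definition cone_weight (eps : R) : 'rV[R]_(n + q + 1) :=
  row_mx (row_mx 0 (const_mx (1 + eps))) (const_mx (-1)).

Lemma cone_weight_base eps a : cone_weight eps 0 (base_index q a) = 0.
Proof. by rewrite !row_mxEl mxE. Qed.
Lemma cone_weight_t eps a : cone_weight eps 0 (t_index n a) = 1 + eps.
Proof. by rewrite row_mxEl row_mxEr mxE. Qed.
Lemma cone_weight_s eps : cone_weight eps 0 (s_index n q) = -1.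
Proof. by rewrite row_mxEr mxE. Qed.
End Weights.

(** * The product metric and its Christoffel symbols *)

Section ProductMetric.
Context (R : realType) (M : topologicalType) (n q : nat) (D : metric_atlas R M n).
Context (hM : riemannian_manifold D).
Let P := prod_atlas q D.

Lemma prod_gramE (i : chart_index P) (p : M * 'rV[R]_q * R) :
  gram i p = block_mx (block_mx (@gram _ _ _ D i p.1.1) 0 0 1%:M) 0 0 1%:M.
Proof. by rewrite /gram /= /prod_coord !row_mxKl. Qed.

Lemma prod_gram_sym (i : chart_index P) (p : M * 'rV[R]_q * R) :
  cdom (chart_at i) p -> (gram i p)^T = gram i p.
Proof.
move=> ip; rewrite prod_gramE !tr_block_mx !trmx0 !trmx1.
by rewrite (rm_metric_sym hM ip).
Qed.

Lemma prod_gram_quad (i : chart_index P) (p : M * 'rV[R]_q * R) (v : 'rV[R]_(n + q + 1)) :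
  (v *m gram i p *m v^T) 0 0 =
  (lsubmx (lsubmx v) *m @gram _ _ _ D i p.1.1 *m (lsubmx (lsubmx v))^T) 0 0 +
  \sum_a v 0 (t_index n a) ^+ 2 + v 0 (s_index n q) ^+ 2.
Proof.
rewrite prod_gramE -[v in LHS]hsubmxK -[lsubmx v in LHS]hsubmxK.
rewrite !(mul_row_block, tr_row_mx, mul_row_col, mulmx0, addr0, add0r, mulmx1).
rewrite [LHS]mxE [X in X + _ = _]mxE; congr (_ + _ + _).
  by rewrite mxE; apply: eq_bigr => a _; rewrite !mxE expr2.
by rewrite mxE big_ord1 !mxE expr2.
Qed.

Lemma prod_gram_pos (i : chart_index P) (p : M * 'rV[R]_q * R) (v : 'rV[R]_(n + q + 1)) :
  cdom (chart_at i) p -> v != 0 -> 0 < (v *m gram i p *m v^T) 0 0.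
Proof.
move=> ip v0; rewrite prod_gram_quad.
have t0 : 0 <= \sum_a v 0 (t_index n a) ^+ 2 by apply: sumr_ge0 => a _; exact: sqr_ge0.
have s0 := sqr_ge0 (v 0 (s_index n q)).
have [vM|vM] := eqVneq (lsubmx (lsubmx v)) 0; last first.
  by have := rm_metric_pos hM ip vM; rewrite -/(gram _ _); lra.
rewrite vM !mul0mx mxE add0r lt_neqAle addr_ge0// andbT eq_sym paddr_eq0//.
apply: contra v0 => /andP[/eqP t00 s00]; apply/eqP/rowP => b; rewrite [RHS]mxE.
have [[a ->]|[a ->]|->] := prod_indexP b.
- by move/rowP : vM => /(_ a); rewrite !mxE.
- move/psumr_eq0P : t00 => /(_ (fun b _ => sqr_ge0 _) a isT) /eqP.
  by rewrite sqrf_eq0 => /eqP.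
- by apply/eqP; rewrite -sqrf_eq0.
Qed.

(** The weights vanish on the base block, and the metric is the identity on the rest. *)
Lemma prod_gram_weight (i : chart_index P) (p : M * 'rV[R]_q * R) (eps : R) :
  gram i p *m diag_mx (cone_weight n q eps) = diag_mx (cone_weight n q eps).
Proof.
rewrite prod_gramE /cone_weight !diag_mx_row !mulmx_block.
by rewrite !(mulmx0, mul0mx, mul1mx, addr0, add0r) linear0 !mulmx0.
Qed.

Lemma prod_metric_fiber (i : chart_index P) x y a b : fiber_index b ->
  metric_at i x a b = metric_at i y a b /\ metric_at i x b a = metric_at i y b a.
Proof.
by case=> [[b' ->]|->]; have [[a' ->]|[a' ->]|->] := prod_indexP a;
  rewrite !(block_mxEul, block_mxEur, block_mxEdl, block_mxEdr).
Qed.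

Lemma fiber_delta_base (b : 'I_(n + q + 1)) : fiber_index b ->
  lsubmx (lsubmx (delta_mx 0 b : 'rV[R]_(n + q + 1))) = 0.
Proof.
move=> fb; apply/rowP => a; rewrite !mxE eqxx /=.
by case: fb => [[b' ->]|->]; rewrite (_ : _ == _ = false)//;
  apply/negP => /eqP /(congr1 val) /=; have := ltn_ord a; lia.
Qed.

Lemma prod_metric_shift (i : chart_index P) x b (h : R) : fiber_index b ->
  metric_at i (h *: delta_mx 0 b + x) = metric_at i x.
Proof.
by move=> fb /=; rewrite !linearD !linearZ /= fiber_delta_base// scaler0 add0r.
Qed.

(** Where [M] has a boundary only one-sided increments are available; the base part of a coordinate
    vector has nonnegative entries and so points inward. *)
Lemma prod_cimg_near (i : chart_index P) (p : M * 'rV[R]_q * R) (b : 'I_(n + q + 1)) :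
  cdom (chart_at i) p ->
  \forall h \near (0 : R)^'+, cimg (chart_at i) (h *: delta_mx 0 b + cfun (chart_at i) p).
Proof.
move=> ip; have [_ [O oO cO] _ _ _] := rm_chart hM i.
set c := @chart_at _ _ _ D i in cO *.
have cp : cimg c (cfun c p.1.1) by exists p.1.1.
have [wc Oc] : model_space (wall c) (cfun c p.1.1) /\ O (cfun c p.1.1).
  by move: cp; rewrite cO.
have nA : \forall y \near cfun c p.1.1, model_space (wall c) y -> cimg c y.
  by apply: filterS (open_nbhs_nbhs (conj oO Oc)) => y Oy wy; rewrite cO.
pose v : 'rV[R]_n := lsubmx (lsubmx (delta_mx 0 b)).
have wv : inward (wall c) v by move=> a _; rewrite !mxE ler0n.
apply: filterS (near_inward wc wv nA) => h [r cr rE].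
set y := _ + _.
exists (r, rsubmx (lsubmx y), rsubmx y 0 0) => //=.
rewrite /prod_coord -/c rE -mx11_scalar -[RHS]hsubmxK -[lsubmx y in RHS]hsubmxK.
by rewrite /y !linearD !linearZ /= /prod_coord !row_mxKl.
Qed.

Lemma prod_cimg_fiber (i : chart_index P) (p : M * 'rV[R]_q * R) (b : 'I_(n + q + 1))
    (h : R) : cdom (chart_at i) p -> fiber_index b ->
  cimg (chart_at i) (h *: delta_mx 0 b + cfun (chart_at i) p).
Proof.
move=> ip fb; set y := _ + _.
exists (p.1.1, rsubmx (lsubmx y), rsubmx y 0 0) => //=.
rewrite /prod_coord -mx11_scalar -[RHS]hsubmxK -[lsubmx y in RHS]hsubmxK.
by rewrite {3}/y !linearD !linearZ /= fiber_delta_base// scaler0 add0r !row_mxKl.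
Qed.

(** Of the three derivatives, two are of metric entries carrying the fiber index [b], which are
    constant, and the third is taken along [b], in which direction the metric does not vary. *)
Lemma christoffel_fiber (i : chart_index P) (p : M * 'rV[R]_q * R) m a b :
  cdom (chart_at i) p -> fiber_index b -> christoffel i p m a b = 0.
Proof.
move=> ip fb; rewrite /christoffel big1 ?mulr0// => l _.
rewrite /partial_in !derive_in_constant ?addr0 ?subr0 ?mulr0//;
  try exact: prod_cimg_near.
- move=> h _; set y := _ + _.
  by case: (prod_metric_fiber i y (cfun (chart_at i) p) a fb).
- by move=> h _; rewrite prod_metric_shift.
- move=> h _; set y := _ + _.
  by case: (prod_metric_fiber i y (cfun (chart_at i) p) l fb).
Qed.

End ProductMetric.

Lemma eucl_norm_ge0 (R : realType) (m : nat) (t : 'rV[R]_m) : 0 <= eucl_norm t.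
Proof. exact: sqrtr_ge0. Qed.

Lemma eucl_norm_shift (R : realType) (m : nat) (t : 'rV[R]_m) (a : 'I_m) (h : R) :
  0 <= h * t 0 a -> eucl_norm t <= eucl_norm (h *: delta_mx 0 a + t).
Proof.
move=> hta; rewrite ler_sqrt; last by apply: sumr_ge0 => b _; exact: sqr_ge0.
apply: ler_sum => b _; rewrite !mxE eqxx /= eq_sym.
by case: (eqVneq a b) => [<-|_]; rewrite ?mulr1 ?mulr0 ?add0r//; nra.
Qed.

(** * The differential of the logarithmic weight *)

Section ProductWeight.
Context (R : realType) (M : topologicalType) (n q : nat) (D : metric_atlas R M n).
Context (hM : riemannian_manifold D) (h : M -> R) (delta : R -> R)
  (psi : M * 'rV[R]_q * R -> R).
Context (delta_nd : forall r r' : R, 0 <= r -> r <= r' -> delta r <= delta r')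
  (weight : forall p t s, expR (psi (p, t, s)) = expR (h p) * expR (delta (eucl_norm t))).
Let P := prod_atlas q D.

Lemma log_weightE p t s : psi (p, t, s) = h p + delta (eucl_norm t).
Proof. by apply: expR_inj; rewrite weight expRD. Qed.

Definition weight_partial (i : chart_index P) (p : M * 'rV[R]_q * R) b : R :=
  partial_in (cimg (chart_at i)) (psi \o cinv (chart_at i) : _ -> R)
    (cfun (chart_at i) p) b.

Lemma weight_partial_s (i : chart_index P) p : cdom (chart_at i) p ->
  weight_partial i p (s_index n q) = 0.
Proof.
move=> ip; apply: derive_in_constant; first exact: (prod_cimg_near hM).
move=> e _ /=; rewrite !log_weightE.
have -> // : lsubmx (e *: delta_mx 0 (s_index n q) +
    prod_coord (cfun (@chart_at _ _ _ D i) p.1.1) p.1.2 p.2) =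
  lsubmx (prod_coord (cfun (@chart_at _ _ _ D i) p.1.1) p.1.2 p.2).
apply/rowP => a; rewrite mxE [in LHS]mxE [X in X + _]mxE.
rewrite [delta_mx _ _ _ _]mxE eqxx /= (_ : _ == _ = false) ?mulr0 ?add0r ?mxE//.
by apply/negP => /eqP /(congr1 val) /=; have := ltn_ord a; lia.
Qed.

(* When its defining limit does not exist, [weight_partial] is the junk value 0. *)
Lemma weight_partial_t (i : chart_index P) p (a : 'I_q) : cdom (chart_at i) p ->
  0 <= p.1.2 0 a * weight_partial i p (t_index n a).
Proof.
move=> ip; set t := p.1.2.
have -> : weight_partial i p (t_index n a) =
    lim ((fun e : R => e^-1 * (delta (eucl_norm (e *: delta_mx 0 a + t)) - delta (eucl_norm t)))
      @ 0^').
  rewrite /weight_partial /partial_in /derive_in.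
  (* Moving in the Euclidean factor never leaves the chart image, so the limit is two-sided. *)
  have -> : [set e : R | cimg (chart_at i)
      (e *: delta_mx 0 (t_index n a) + cfun (chart_at i) p)] = setT.
    by apply/seteqP; split=> // e _; apply: prod_cimg_fiber => //; left; exists a.
  rewrite withinET; apply: (congr1 (fun f : R -> R => lim (f @ (0 : R)^'))).
  apply/funext => e /=.
  rewrite !log_weightE !linearD !linearZ /= fiber_delta_base; last by left; exists a.
  rewrite scaler0 add0r /prod_coord !(row_mxKl, row_mxKr).
  have -> : rsubmx (lsubmx (delta_mx 0 (t_index n a))) = delta_mx 0 a :> 'rV[R]_q.
    by apply/rowP => b; rewrite !mxE eqxx /= /t_index eq_lshift eq_rshift.
  by rewrite /GRing.scale /= -/t; ring.
set Qf := fun e : R => _.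
have [cQ|/dvgP ->] := pselect (cvg (Qf @ 0^')); last by rewrite mulr0.
(* The increment is given the sign of [t 0 a], so that the norm grows and [delta] does not decrease:
   the quotient, and hence its one-sided limit, has the sign of [t 0 a] or is zero. *)
have [t0|t0|->] := ltgtP (t 0 a) 0; last by rewrite mul0r.
  rewrite nmulr_rge0// (cvg_at_leftE _ _ cQ).
  apply: limr_le; first exact: cvgP (cvg_dnbhs_at_left cQ).
  rewrite near_withinE; near=> e => e0.
  rewrite /Qf nmulr_rle0 ?invr_lt0// subr_ge0 delta_nd ?eucl_norm_ge0//.
  by apply: eucl_norm_shift; rewrite nmulr_rge0// ltW.
rewrite pmulr_rge0// (cvg_at_rightE _ _ cQ).
apply: limr_ge; first exact: cvgP (cvg_dnbhs_at_right cQ).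
rewrite near_withinE; near=> e => e0.
rewrite /Qf pmulr_rge0 ?invr_gt0// subr_ge0 delta_nd ?eucl_norm_ge0//.
by apply: eucl_norm_shift; rewrite mulr_ge0// ltW.
Unshelve. all: by end_near. Qed.

End ProductWeight.

(** * The maximum principle *)

Lemma Ck_on_subset (R : realType) (V W : normedModType R) (k : nat) (U U' : set V)
    (f : V -> W) : U' `<=` U -> Ck_on k U f -> Ck_on k U' f.
Proof.
move=> sU; elim: k f => [|k IHk] f [cf df]; split.
- by move=> x /sU; exact: cf.
- by [].
- by move=> x /sU; exact: cf.
- move=> v; have [dfv Cfv] := df v; split; last exact: IHk.
  by move=> x /sU; exact: dfv.
Qed.

Lemma near_interior_model (R : realType) (e : nat) (w : option 'I_e) (x : 'rV[R]_e) :
  model_space w x -> ~ (exists2 a, w = Some a & x 0 a = 0) ->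
  \forall y \near x, model_space w y.
Proof.
case: w => [a|] /=; last by move=> _ _; exact: filterT.
move=> xa0 nw; have {}xa0 : 0 < x 0 a.
  by rewrite lt_neqAle xa0 andbT eq_sym; apply/eqP => xa; apply: nw; exists a.
have := @coord_continuous R 1 e 0 a x => /cvgr_gt /(_ 0 xa0).
by apply: filterS => y /ltW.
Qed.

Lemma lsubmx_continuous (R : realType) (m n1 n2 : nat) :
  continuous (lsubmx : 'M[R]_(m, n1 + n2) -> 'M[R]_(m, n1)).
Proof. by move=> A; apply: differentiable_continuous; exact: differentiable_lsubmx. Qed.

(** This is the comparison function f; in product coordinates it is the diagonal quadratic function
    with weights [cone_weight]. *)
Definition cone_quadratic (R : realType) (T : Type) (q : nat) (eps : R)
    (z : T * 'rV[R]_q * R) : R :=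
  (1 + eps) * (\sum_a z.1.2 0 a ^+ 2) - z.2 ^+ 2.

Section GramContinuity.
Context (R : realType) (M : topologicalType) (n q : nat) (D : metric_atlas R M n).
Context (hM : riemannian_manifold D).
Let P := prod_atlas q D.

(** Outside the base block the entries are constant. Inside it, a local smooth extension of the
    metric of [M] is composed with the base coordinates of [F]. *)
Lemma prod_gram_continuous (i : chart_index P) (m : nat) (x : 'rV[R]_m)
    (p : 'rV[R]_m -> M * 'rV[R]_q * R) (F : 'rV[R]_m -> 'rV[R]_(n + q + 1)) a b :
  (\forall y \near x, cdom (chart_at i) (p y)) ->
  (\forall y \near x, cfun (chart_at i) (p y) = F y) -> {for x, continuous F} ->
  {for x, continuous (fun y => gram i (p y) a b)}.
Proof.
move=> ip pF cF.
have const b' : fiber_index b' -> forall a',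
    {for x, continuous (fun y => gram i (p y) a' b')} /\
    {for x, continuous (fun y => gram i (p y) b' a')}.
  move=> fb a'; split.
    rewrite (_ : (fun y => _) = cst (gram i (p x) a' b')); first exact: cst_continuous.
    apply/funext => y; rewrite /gram /cst.
    by case: (prod_metric_fiber i (cfun (chart_at i) (p y)) (cfun (chart_at i) (p x)) a' fb).
  rewrite (_ : (fun y => _) = cst (gram i (p x) b' a')); first exact: cst_continuous.
  apply/funext => y; rewrite /gram /cst.
  by case: (prod_metric_fiber i (cfun (chart_at i) (p y)) (cfun (chart_at i) (p x)) a' fb).
have [[b' ->]|[b' ->]|->] := prod_indexP b; last 2 first.
- by have [] := const (t_index n b') (or_introl (ex_intro _ b' erefl)) a.
- by have [] := const (s_index n q) (or_intror erefl) a.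
have [[a' ->]|[a' ->]|->] := prod_indexP a; last 2 first.
- by have [] := const (t_index n a') (or_introl (ex_intro _ a' erefl)) (base_index q b').
- by have [] := const (s_index n q) (or_intror erefl) (base_index q b').
have gE y : gram i (p y) (base_index q a') (base_index q b') =
    metric_at (m := D) i (cfun (@chart_at _ _ _ D i) (p y).1.1) a' b'.
  by rewrite prod_gramE /base_index !block_mxEul.
have FE : \forall y \near x, cfun (@chart_at _ _ _ D i) (p y).1.1 = lsubmx (lsubmx (F y)).
  by apply: filterS pF => y <-; rewrite /= /prod_coord !row_mxKl.
have cL : {for x, continuous (fun y => lsubmx (lsubmx (F y)))}.
  have cl (A : 'rV[R]_(n + q + 1)) : {for A, continuous (fun z : 'rV[R]_(n + q + 1) =>
      lsubmx (lsubmx z))}.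
    by apply: (@continuous_comp _ _ _ lsubmx lsubmx); exact: lsubmx_continuous.
  by apply: (@continuous_comp _ _ _ F (fun z : 'rV[R]_(n + q + 1) =>
    lsubmx (lsubmx z))); [exact: cF|exact: cl].
have imx : cimg (@chart_at _ _ _ D i) (lsubmx (lsubmx (F x))).
  by rewrite -(nbhs_singleton FE); exists (p x).1.1 => //; exact: (nbhs_singleton ip).
have [U [H [oU Ux CH HE]]] := rm_metric_smooth hM a' b' imx.
have [cH _] := CH 0%N.
have cHL : {for x, continuous (fun y => H (lsubmx (lsubmx (F y))))}.
  by apply: (@continuous_comp _ _ _ (fun y => lsubmx (lsubmx (F y))) H);
    [exact: cL|exact: cH].
apply: near_eq_continuous cHL.
have nU : \forall y \near x, U (lsubmx (lsubmx (F y))).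
  by apply: cL; exact: open_nbhs_nbhs.
near=> y; rewrite gE.
have -> : cfun (@chart_at _ _ _ D i) (p y).1.1 = lsubmx (lsubmx (F y)) by near: y.
rewrite -HE//; first by near: y.
have <- : cfun (@chart_at _ _ _ D i) (p y).1.1 = lsubmx (lsubmx (F y)) by near: y.
by exists (p y).1.1 => //; near: y.
Unshelve. all: by end_near. Qed.

End GramContinuity.

Section InteriorMaximum.
Context (R : realType) (M : topologicalType) (n q : nat) (D : metric_atlas R M n).
Context (hM : riemannian_manifold D) (h : M -> R) (delta : R -> R)
  (psi : M * 'rV[R]_q * R -> R).
Context (delta_nd : forall r r' : R, 0 <= r -> r <= r' -> delta r <= delta r')
  (weight : forall p t s, expR (psi (p, t, s)) = expR (h p) * expR (delta (eucl_norm t))).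
Let P := prod_atlas q D.

(** The Christoffel term dies since [V] has only fiber components, for which the symbols vanish. The
    factor [lam] stays because [N] itself is known to have this property only when [lam] is
    nonzero. *)
Lemma cov_normal_collinear (N : chart_index P -> M * 'rV[R]_q * R -> 'rV[R]_(n + q + 1))
    (c : chart R (M * 'rV[R]_q * R)%type (n + q + 1).-1) (i : chart_index P) p
    (lam : R) (V : 'rV[R]_(n + q + 1)) :
  cdom (chart_at i) p -> V = lam *: N i p -> (forall a, V 0 (base_index q a) = 0) ->
  lam *: cov_normal N c i p = lam *: jacobian_in (hs_dom c i) (N i \o cinv c) (cfun c p).
Proof.
move=> ip VN Vb; have VNb b : V 0 b = lam * N i p 0 b by rewrite VN mxE.
rewrite /cov_normal scalerDr -[RHS]addr0; congr (_ + _).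
apply/matrixP => u m; rewrite !mxE mulr_sumr big1// => a _.
rewrite mulr_sumr big1// => b _.
have -> : lam * (christoffel i p m a b * hs_jacobian c i p u a * N i p 0 b) =
    christoffel i p m a b * hs_jacobian c i p u a * V 0 b.
  by rewrite VNb; ring.
have [[b' ->]|[b' ->]|->] := prod_indexP b.
- by rewrite Vb mulr0.
- by rewrite (christoffel_fiber hM) ?mul0r//; left; exists b'.
- by rewrite (christoffel_fiber hM) ?mul0r//; right.
Qed.

Lemma no_interior_max (S : set (M * 'rV[R]_q * R))
    (N : chart_index P -> M * 'rV[R]_q * R -> 'rV[R]_(n + q + 1))
    (c : chart R (M * 'rV[R]_q * R)%type (n + q + 1).-1) (i : chart_index P)
    (p : M * 'rV[R]_q * R) (eps : R) :
  (1 < q)%N -> 0 < eps -> unit_normal S N -> psi_minimal psi S N ->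
  hypersurface_chart P S c -> cdom c p -> cdom (chart_at i) p -> ~ on_wall c p ->
  ~ (forall z, S z -> cone_quadratic eps z <= cone_quadratic eps p).
Proof.
move=> q1 eps0 [_ N_smooth N_unit N_normal] S_minimal Sc cp ip nwall pmax.
have [cS X_smooth X_imm] := Sc.
set x := cfun c p.
have Ax : hs_dom c i x by exists p.
have [_ _ _ Sp' wx] := hs_domK cS Ax.
have xK : cinv c x = p by case: cS => _ _ + _ _; apply.
have Sp : S p by rewrite -xK.
(* Off the wall the model space is a full neighborhood of [x]. *)
have nA : nbhs x (hs_dom c i).
  have := near_interior_model wx nwall.
  by apply: filterS2 (hs_dom_near cS (@prod_cdom_open _ _ _ q _ hM i) cp ip) => y; apply.
have [U1 [F [oU1 U1x CF1 XF1]]] := X_smooth i x Ax.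
have [U2 [nu [oU2 U2x Cnu2 Nnu2]]] := N_smooth c i Sc x Ax.
(* Inside the interior of [hs_dom c i] the smooth extensions [F] and [nu] coincide with the
   parametrization and the normal, so ordinary derivatives may be used on [U]. *)
pose U := U1 `&` U2 `&` (hs_dom c i)°.
have oU : open U by apply: openI; [exact: openI|exact: open_interior].
have Ux : U x by split.
have nU := open_nbhs_nbhs (conj oU Ux).
have UA y : U y -> hs_dom c i y by move=> [_ /interior_subset].
have XF y : U y -> cfun (chart_at i) (cinv c y) = F y.
  by move=> Uy; rewrite -XF1//; [case: Uy => -[]|exact: UA].
have Nnu y : U y -> N i (cinv c y) = nu y.
  by move=> Uy; rewrite -Nnu2//; [case: Uy => -[]|exact: UA].
have CF k : Ck_on k U F by apply: Ck_on_subset (CF1 k) => y [[]].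
have Cnu k : Ck_on k U nu by apply: Ck_on_subset (Cnu2 k) => y [[]].
have modelU y : U y -> model_space (wall c) y.
  by move=> /UA /(hs_domK cS)[].
have nUA y : U y -> \forall z \near y, model_space (wall c) z -> hs_dom c i z.
  by move=> Uy; apply: filterS (open_nbhs_nbhs (conj oU Uy)) => z /UA.
pose JF y : 'M[R]_((n + q + 1).-1, n + q + 1) := \matrix_(a, b) 'D_(delta_mx 0 a) F y 0 b.
have JE y : U y -> hs_jacobian c i (cinv c y) = JF y.
  move=> Uy; have Ay := UA y Uy; have [_ _ yK _ _] := hs_domK cS Ay.
  rewrite /hs_jacobian yK; apply: jacobian_inE Ay (modelU y Uy) (nUA y Uy) oU Uy _ (CF 1%N).
  by move=> z Uz _; exact: XF.
have JNE : jacobian_in (hs_dom c i) (N i \o cinv c) x =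
    \matrix_(a, b) 'D_(delta_mx 0 a) nu x 0 b.
  apply: jacobian_inE Ax wx (nUA x Ux) oU Ux _ (Cnu 1%N).
  by move=> z Uz _; exact: Nnu.
set g := gram i p; set J := hs_jacobian c i p.
have JFx : JF x = J by rewrite -JE// xK.
have Nx : nu x = N i p by rewrite -Nnu// xK.
pose w : 'rV[R]_(n + q + 1) := cone_weight n q eps.
pose Q := diag_mx w.
have CFx : {for x, continuous F} by case: (CF 0%N) => + _; apply.
have ipy y : U y -> cdom (chart_at i) (cinv c y) by move=> /UA /(hs_domK cS)[].
have phiE y : U y -> \sum_b w 0 b * F y 0 b ^+ 2 = cone_quadratic eps (cinv c y).
  move=> Uy; rewrite -XF// sum_prod_index big1 ?add0r; last first.
    by move=> a _; rewrite cone_weight_base mul0r.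
  rewrite cone_weight_s prod_coord_s mulN1r /cone_quadratic mulr_sumr; congr (_ - _).
  by apply: eq_bigr => a _; rewrite cone_weight_t prod_coord_t.
have [] := @quadratic_max _ _ _ U x F w oU Ux (CF 2%N).
  apply: filterS nU => y Uy; rewrite !phiE// xK; apply: pmax.
  by have [] := hs_domK cS (UA y Uy).
rewrite -/(JF x) JFx; set V := F x *m diag_mx w; set K := \matrix_(u, w) _.
move=> JV Hess.
have QT : Q^T = Q by rewrite tr_diag_mx.
have gQ z : cdom (chart_at i) z -> gram i z *m Q = Q by move=> _; exact: prod_gram_weight.
have Vg z : cdom (chart_at i) z -> V *m gram i z = V.
  move=> iz; rewrite /V -mulmxA; congr (_ *m _); apply: trmx_inj.
  by rewrite trmx_mul (prod_gram_sym hM)// -/Q QT gQ.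
have g_sym : g^T = g by exact: (prod_gram_sym hM).
have g_pos (v : 'rV[R]_(n + q + 1)) : v != 0 -> 0 < (v *m g *m v^T) 0 0.
  by move=> v0; exact: (prod_gram_pos hM ip v0).
have g_unit : g \in unitmx by exact: posdef_unitmx g_pos.
have J_free : row_free J by exact: X_imm.
have em : (n + q + 1 <= (n + q + 1).-1.+1)%N by exact: leqSpred.
have nu_unit : N i p *m g *m (N i p)^T = 1%:M by exact: N_unit.
have nu_normal : N i p *m g *m J^T = 0 by exact: N_normal.
have VN := normal_collinear em J_free g_sym g_pos nu_unit nu_normal (Vg p ip) JV.
set lam := (V *m (N i p)^T) 0 0 in VN.
have Vbase a : V 0 (base_index q a) = 0.
  by rewrite /V mul_mx_diag mxE cone_weight_base mulr0.
(* Entrywise, this is the differentiated orthogonality of the normal and the [v]-th coordinate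
   vector field along direction [u]. *)
have shape : lam *: (cov_normal N c i p *m g *m J^T) = - K.
  rewrite !scalemxAl (cov_normal_collinear _ ip VN Vbase) JNE -!scalemxAl.
  apply/matrixP => u v; rewrite [LHS]mxE [RHS]mxE [K u v]mxE.
  pose Xv y : 'rV[R]_(n + q + 1) := \row_b 'D_(delta_mx 0 v) F y 0 b.
  have XvE y : Xv y = row v (JF y) by apply/rowP => b; rewrite !mxE.
  have dXv b : (fun y => Xv y 0 b) = (fun y => 'D_(delta_mx 0 v) F y 0 b).
    by apply/funext => y; rewrite mxE.
  have CXv b : Ck_on 1 U (fun y => Xv y 0 b).
    rewrite dXv; apply: Ck_on_coord => //.
    by case: (CF 2%N) => _ /(_ (delta_mx 0 v))[].
  have key : lam * ('D_(delta_mx 0 u) nu x *m g *m (Xv x)^T) 0 0 =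
      - \sum_b V 0 b * 'D_(delta_mx 0 u) (fun y => Xv y 0 b) x.
    rewrite /g -xK; apply: (@normal_derivative _ _ _ x (delta_mx 0 u) nu
      (fun y => gram i (cinv c y)) Xv V lam).
    - apply: filterS nU => y Uy; rewrite -Nnu// XvE -JE// tr_row.
      have [cy _ _ _ _] := hs_domK cS (UA y Uy).
      by rewrite colE mulmxA (N_normal c i _ Sc cy (ipy y Uy)) mul0mx mxE.
    - by apply: filterS nU => y Uy; apply: Vg; exact: ipy.
    - by rewrite Nx.
    - by case: (Cnu 1%N) => _ /(_ (delta_mx 0 u)) [+ _]; apply.
    - by move=> b; case: (CXv b) => _ /(_ (delta_mx 0 u)) [+ _]; apply.
    - by move=> b; case: (CXv b) => + _; apply.
    - move=> a b; apply: (prod_gram_continuous hM) CFx.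
        by apply: filterS nU => y Uy; exact: ipy.
      by apply: filterS nU => y Uy; exact: XF.
  transitivity (lam * ('D_(delta_mx 0 u) nu x *m g *m (Xv x)^T) 0 0).
    congr (_ * _); rewrite XvE JFx.
    set DN := \matrix_(a, b) _.
    have -> : 'D_(delta_mx 0 u) nu x = row u DN by apply/rowP => b; rewrite !mxE.
    by rewrite tr_row colE mulmxA -!row_mul -colE [RHS]mxE [RHS]mxE.
  rewrite key; congr (- _); apply: eq_bigr => b _; congr (_ * _).
  by rewrite dXv.
have := trace_second_order em J_free g_sym g_pos nu_unit nu_normal (gQ p ip) QT Hess.
(* By [shape] the trace is [- lam] times the divergence of the normal, and psi-minimality turns this
   into the differential of [psi] on [lam *: N i p], that is on [V]. *)
have -> : \tr (invmx (J *m g *m J^T) *m K) =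
    \sum_b weight_partial psi i p b * V 0 b.
  have -> : K = - (lam *: (cov_normal N c i p *m g *m J^T)) by rewrite shape opprK.
  rewrite mulmxN -scalemxAr linearN linearZ /=.
  have := S_minimal c i p Sc cp ip; rewrite /psi_mean_curvature /hs_divergence.
  rewrite /first_fundamental_form -/g -/J => /eqP; rewrite subr_eq0 eqr_oppLR => /eqP ->.
  rewrite /gradient mulmxKV// mulrN opprK.
  rewrite [in RHS]VN mxE mulr_sumr; apply: eq_bigr => b _.
  by rewrite !mxE /weight_partial; ring.
rewrite sum_prod_index big1 ?add0r; last by move=> a _; rewrite Vbase mulr0.
rewrite (weight_partial_s hM weight ip) mul0r addr0.
have grad_ge0 : 0 <= \sum_a weight_partial psi i p (t_index n a) * V 0 (t_index n a).
  apply: sumr_ge0 => a _; rewrite /V mul_mx_diag mxE cone_weight_t -XF// xK prod_coord_t.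
  by rewrite mulrA mulr_ge0//; [rewrite mulrC (weight_partial_t delta_nd weight)|lra].
have trQ : \tr Q = (1 + eps) * q%:R - 1.
  rewrite mxtrace_diag sum_prod_index big1 ?add0r; last by move=> a _; exact: cone_weight_base.
  rewrite cone_weight_s; congr (_ - _).
  under eq_bigr do rewrite cone_weight_t.
  by rewrite sumr_const card_ord mulr_natr.
have nuQ : (N i p *m Q *m (N i p)^T) 0 0 =
    (1 + eps) * (\sum_a N i p 0 (t_index n a) ^+ 2) - N i p 0 (s_index n q) ^+ 2.
  rewrite diag_quadE sum_prod_index big1 ?add0r; last first.
    by move=> a _; rewrite cone_weight_base mul0r.
  rewrite mulr_sumr cone_weight_s mulN1r; congr (_ - _).
  by apply: eq_bigr => a _; rewrite cone_weight_t.
have := nu_unit => /matrixP /(_ 0 0); rewrite prod_gram_quad [RHS]mxE eqxx mulr1n => unitE.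
have base_ge0 : 0 <= (lsubmx (lsubmx (N i p)) *m @gram _ _ _ D i p.1.1 *m
    (lsubmx (lsubmx (N i p)))^T) 0 0.
  have [->|v0] := eqVneq (lsubmx (lsubmx (N i p))) 0; first by rewrite !mul0mx mxE.
  exact/ltW/(rm_metric_pos hM ip v0).
have s2 := sqr_ge0 (N i p 0 (s_index n q)).
have q2 : 2 <= q%:R :> R by rewrite ler_nat.
(* Here [T + s + b = 1] with [s] and [b] nonnegative, so [T <= 1]. Together with [2 <= q] this
   bounds the expression below by [(1 + eps) (q - 1) - 1], which is at least [eps]. *)
rewrite trQ nuQ; move: grad_ge0 unitE base_ge0 s2 q2.
move: (\sum_a _) (\sum_a _) (_ ^+ 2) (_ 0 0) => G T s b.
nra.
Qed.

End InteriorMaximum.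

Lemma t_coord_continuous (R : realType) (T : topologicalType) (q : nat) (a : 'I_q) :
  continuous (fun z : T * 'rV[R]_q * R => z.1.2 0 a).
Proof.
move=> z; apply: (@continuous_comp _ _ _ (fun z : T * 'rV[R]_q * R => z.1.2)
  (fun t : 'rV[R]_q => t 0 a)); last exact: coord_continuous.
by apply: (@continuous_comp _ _ _ fst snd); [exact: cvg_fst|exact: cvg_snd].
Qed.

Lemma cone_quadratic_continuous (R : realType) (T : topologicalType) (q : nat) (eps : R) :
  continuous (@cone_quadratic R T q eps).
Proof.
move=> z; apply: cvgB.
  apply: cvgMl_tmp; apply: cvg_finite_sum => a.
  have H := @t_coord_continuous R T q a z.
  exact: (cvgM H H).
have H : z.2 @[z --> z] --> z.2 by exact: cvg_snd.
exact: (cvgM H H).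
Qed.

Lemma rho_cone_quadratic (R : realType) (T : Type) (q : nat) (eps : R)
    (z : T * 'rV[R]_q * R) :
  cone_quadratic eps z = rho z + eps * eucl_norm z.1.2 ^+ 2.
Proof. by rewrite /cone_quadratic /rho sqr_eucl_norm; ring. Qed.

Section WeakMaximumPrinciple.
Context (R : realType) (M : topologicalType) (n q : nat) (D : metric_atlas R M n).
Context (hM : riemannian_manifold D) (h : M -> R) (delta : R -> R)
  (psi : M * 'rV[R]_q * R -> R).
Context (delta_nd : forall r r' : R, 0 <= r -> r <= r' -> delta r <= delta r')
  (weight : forall p t s, expR (psi (p, t, s)) = expR (h p) * expR (delta (eucl_norm t))).
Let P := prod_atlas q D.

(** If [rho] were positive at [z0], a small [eps] would keep f on the boundary below its value at
    [z0]. Its maximum on the compact [S] would then be interior, which [no_interior_max]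
    excludes. *)
Lemma rho_le0 (S : set (M * 'rV[R]_q * R))
    (N : chart_index P -> M * 'rV[R]_q * R -> 'rV[R]_(n + q + 1)) :
  (1 < q)%N -> hypersurface P S -> unit_normal S N -> compact S ->
  psi_minimal psi S N -> hs_boundary P S `<=` [set z | rho z <= 0] ->
  forall z, S z -> rho z <= 0.
Proof.
move=> q1 S_hyp S_normal S_compact S_min S_bd z0 Sz0; rewrite leNgt; apply/negP => rho0.
have S0 : S !=set0 by exists z0.
have max_on (f : M * 'rV[R]_q * R -> R) : continuous f ->
    exists2 p, S p & forall z, S z -> f z <= f p.
  move=> cf; have [p /set_mem Sp pmax] :=
    compact_EVT_max S0 S_compact (continuous_subspaceT cf).
  by exists p => // z Sz; apply: pmax; exact/mem_set.
pose t2 (z : M * 'rV[R]_q * R) := eucl_norm z.1.2 ^+ 2.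
have t2E z : t2 z = \sum_a z.1.2 0 a ^+ 2 by exact: sqr_eucl_norm.
have t2_continuous : continuous t2.
  move=> z; rewrite (_ : t2 = fun z => \sum_a z.1.2 0 a * z.1.2 0 a); last first.
    by apply/funext => y; rewrite t2E; apply: eq_bigr => a _; rewrite expr2.
  apply: cvg_finite_sum => a; have H := @t_coord_continuous R M q a z.
  exact: (cvgM H H).
have [zc Szc zc_max] := max_on _ t2_continuous.
set C := t2 zc in zc_max.
have C0 : 0 <= C by exact: sqr_ge0.
(* Since [C] is the maximum of [|t|^2] on [S], the perturbation [eps |t|^2] stays below [rho z0];
   the added 1 avoids division by zero. *)
pose eps := rho z0 / (C + 1).
have eps0 : 0 < eps by rewrite divr_gt0// ltr_wpDl.
have epsC : eps * C < rho z0.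
  by rewrite /eps mulrAC ltr_pdivrMr ?ltr_wpDl// ltr_pM2l// ltrDl.
have [p Sp pmax] := max_on _ (@cone_quadratic_continuous R M q eps).
have p_int : ~ hs_boundary P S p.
  move=> /S_bd /= rhop; have := pmax z0 Sz0; rewrite !rho_cone_quadratic.
  have := zc_max p Sp; rewrite /t2 => tp.
  have := ler_wpM2l (ltW eps0) tp.
  have : 0 <= eps * eucl_norm z0.1.2 ^+ 2 by rewrite mulr_ge0 ?sqr_ge0// ltW.
  lra.
have [c cS cp] := S_hyp p Sp; have [i ip] := prod_cover hM p.
have nwall : ~ on_wall c p by move=> wp; apply: p_int; exists c.
exact: (no_interior_max hM delta_nd weight q1 eps0 S_normal S_min cS cp ip nwall pmax).
Qed.

End WeakMaximumPrinciple.

(** * Conclusion by connectedness *)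

Theorem mainTheorem12 (R : realType) (n k : nat) (hk : (3 <= k)%N)
    (M : topologicalType) (D : metric_atlas R M n)
    (hM : riemannian_manifold D) (M_connected : connected [set: M])
    (o : chart_index D -> M -> bool) (M_oriented : orientation o)
    (h : M -> R) (h_C1 : Ck_function D 1 h)
    (delta : R -> R)
    (delta_C1 : Ck_within 1 [set r : R | 0 <= r] delta)
    (delta_nondecreasing : forall r r' : R, 0 <= r -> r <= r' ->
       delta r <= delta r')
    (delta'0 : derive_in [set r : R | 0 <= r] delta 0 1 = 0)
    (psi : M * 'rV[R]_(k.-1) * R -> R)
    (weight : forall (p : M) (t : 'rV[R]_(k.-1)) (s : R),
       expR (psi (p, t, s)) = expR (h p) * expR (delta (eucl_norm t)))
    (Sigma : set (M * 'rV[R]_(k.-1) * R))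
    (Sigma_hypersurface : hypersurface (prod_atlas k.-1 D) Sigma)
    (N : chart_index (prod_atlas k.-1 D) -> M * 'rV[R]_(k.-1) * R ->
         'rV[R]_(n + k.-1 + 1))
    (Sigma_two_sided : unit_normal Sigma N)
    (Sigma_compact : compact Sigma) (Sigma_connected : connected Sigma)
    (Sigma_minimal : psi_minimal psi Sigma N)
    (boundary_sub : hs_boundary (prod_atlas k.-1 D) Sigma
                      `<=` [set z | rho z <= 0]) :
  ~ ((hs_boundary (prod_atlas k.-1 D) Sigma
        `&` [set z | rho z <= 0 /\ 0 < z.2]) !=set0 /\
     (hs_boundary (prod_atlas k.-1 D) Sigma
        `&` [set z | rho z <= 0 /\ z.2 < 0]) !=set0).
Proof.
case=> [[zp [bdp [_ sp]]] [zm [bdm [_ sm]]]].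
have q1 : (1 < k.-1)%N by lia.
have Srho := rho_le0 hM delta_nondecreasing weight q1 Sigma_hypersurface
  Sigma_two_sided Sigma_compact Sigma_minimal boundary_sub.
have bdS z : hs_boundary (prod_atlas k.-1 D) Sigma z -> Sigma z.
  by case=> c [[[[O _ ->] _ _ _ _] _ _] [Sz _] _].
have s_continuous : {within Sigma, continuous (fun z : M * 'rV[R]_(k.-1) * R => z.2)}.
  by apply: continuous_subspaceT => z; exact: cvg_snd.
have /connected_intervalP s_interval :=
  connected_continuous_connected Sigma_connected s_continuous.
(* The image of [Sigma] under the height [s] is an interval containing a positive and a negative
   value. *)
have [z Sz z0] : [set z.2 | z in Sigma] 0.
  apply: (s_interval zm.2 zp.2); [by exists zm; [exact: bdS|]|
    by exists zp; [exact: bdS|]|by rewrite !ltW].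
by have := vertex_not_in_hypersurface hM q1 Sigma_hypersurface Sz Srho; rewrite z0 eqxx.
Qed.
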